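(* Let $G$ be a connected $4K_1$-free graph and let $u\in V(G)$. Then $G$ has a Hamiltonian path starting at $u$ if and only if all of the following conditions hold. (a) $G$ has a Hamiltonian path; equivalently, for every articulation point $x$ of $G$, $G-\{x\}$ has exactly 2 components, and no 3 articulation points of $G$ induce a triangle in $G$. (b) $u$ is not an articulation point of $G$. (c) For every articulation point $x\neq u$ of $G$, letting $Q_u$ be the component of $G-\{x\}$ containing $u$: if $G[Q_u]$ is not 2-connected, then for every articulation point $y\neq u$ of $G[Q_u]$ there exists a vertex $v\in Q_u$ adjacent to $x$ such that $u$ and $v$ lie in different components of $G[Q_u]-\{y\}$. (d) For every articulation point $x\neq u$ of $G$, letting $Q_u$ be the component of $G-\{x\}$ containing $u$: if $G[Q_u]$ is 2-connected, then there exists $v\in Q_u$ adjacent to $x$ with $v\neq u$ such that $\{u,v\}$ is not a minimum vertex cut of $G[Q_u]$. (e) There is no vertex $x$ such that $G-\{u,x\}$ has at least 3 components. (f) If $G$ is 2-connected, then for every minimum vertex cut $\{x,y\}$ of $G$ such that $G-\{x,y\}$ has exactly 2 components, and for a labelling $Q_1,Q_2$ of these two components such that $G[Q_1]$ is a clique: if all neighbours of $x$ in $Q_2$ are articulation points of $G[Q_2]$, then $u\neq y$.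
   Context: Graphs are finite, simple and undirected. A graph is $4K_1$-free if it contains no four pairwise non-adjacent vertices. $G[A]$ denotes the subgraph induced by $A$. A Hamiltonian path is a path containing all vertices; ''starting at $u$'' means $u$ is an end-vertex. A vertex cut of $H$ is a set $A\subset V(H)$ with $H-A$ disconnected; an articulation point is a vertex $x$ with $\{x\}$ a vertex cut. The vertex connectivity of $H$ is the minimum size of a vertex cut ($|V(H)|-1$ if $H$ is complete); $H$ is $k$-connected if its vertex connectivity is at least $k$; a minimum vertex cut is a vertex cut of size equal to the vertex connectivity. *)

(* Defs.v *)
From mathcomp Require Import all_boot.

Set Implicit Arguments.
Unset Strict Implicit.
Unset Printing Implicit Defensive.

(* A finite simple graph G is a symmetric irreflexive relation e on a finType
   T. An induced subgraph G[A] is represented by its vertex set A : {set T},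
   so G itself is G[setT] and G[A] - B is G[A :\: B]. *)

Section Graph.

Variables (T : finType) (e : rel T).
Implicit Types (A B H S : {set T}) (u v x y : T).

Definition induced A : rel T := [rel x y in A | e x y].

Definition components A : {set {set T}} :=
  equivalence_partition (connect (induced A)) A.

(* Total version: it is set0 when u \notin A. *)
Definition component_of A u : {set T} := pblock (components A) u.

(* Stated through membership so that u and v must both be vertices of G[A]. *)
Definition in_different_components A u v : Prop :=
  exists C D : {set T},
    [/\ C \in components A, D \in components A, C != D, u \in C & v \in D].

(* The empty graph is neither connected nor disconnected here: these are
   "exactly one component" and "at least two components". *)
Definition connected A : bool := #|components A| == 1.
Definition disconnected A : bool := 1 < #|components A|.

Definition clique A : bool :=
  [forall x in A, forall y in A, (x != y) ==> e x y].

Definition independent A : bool :=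
  [forall x in A, forall y in A, (x != y) ==> ~~ e x y].

Definition four_K1_free : Prop := forall S, #|S| = 4 -> ~~ independent S.

Definition vertex_cut H A : bool := (A \subset H) && disconnected (H :\: A).

Definition articulation H x : bool := vertex_cut H [set x].

(* A graph that is not complete has a vertex cut, and every vertex cut has
   fewer than #|H| elements, so the default value #|H| is never reached. *)
Definition connectivity H : nat :=
  if clique H then #|H|.-1
  else \big[minn/#|H|]_(A : {set T} | vertex_cut H A) #|A|.

Definition k_connected k H : bool := k <= connectivity H.

Definition min_vertex_cut H A : bool :=
  vertex_cut H A && (#|A| == connectivity H).

Definition ham_path_from u : Prop :=
  exists p : seq T,
    [/\ path e u p, uniq (u :: p) & forall v, v \in u :: p].

Definition has_ham_path : Prop := exists u, ham_path_from u.

End Graph.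

(* Main.v *)
Require Import Defs.
From mathcomp Require Import all_boot.
From mathcomp Require Import zify.

(* Take a longest path P from u and a component H of G - P. A detour through H
   between two of its attachments on P, rerouted along an edge joining their
   successors, would be longer; so a vertex of H and the successors of the
   attachments are independent, and H has at most two attachments. If there are two
   and u is not one of them, a finer rotation argument (detour_absorb) again
   lengthens P. Hence, when G has no articulation point, either P is Hamiltonian or
   u lies in a cut {u, x}; then (e) leaves two components, one of them a clique, and
   (f) lets the path run u, clique, x, other component.
   If x is an articulation point, G - x has two components with independence numbers
   adding up to at most 3, and the path is glued at x: the far component can always
   be entered from x at a non-articulation vertex, and (c), (d), (e) provide a
   Hamiltonian path of the component of u ending at a neighbour of x. *)

Set Implicit Arguments.
Unset Strict Implicit.
Unset Printing Implicit Defensive.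

(** Independence number 3 leaves room for two attachments different from u, and there a single
    rerouting is not enough: this is what [detour_absorb] is for. A component of G - x has
    independence number at most 2, because a vertex of another component can be added to any
    independent set; there one rerouting suffices, even with both ends prescribed. For necessity,
    deleting a vertex of a Hamiltonian path leaves at most two segments, each inducing a connected
    graph, and so does deleting the first vertex u together with x. Every condition is read off from
    this. The witness v in (c) and (d) is the predecessor of x on the path; for (f) it is the path
    neighbour of x that lies in Q2. For the equivalence inside (a) without articulation points the
    start is free too: a detour at the first vertex could be put in front of the path, so the
    exceptional cut through u does not arise. *)

Lemma count_rcons (T : Type) (a : pred T) s z : count a (rcons s z) = count a s + a z.
Proof. by rewrite -cats1 count_cat /= addn0. Qed.

(** Lists are permutations of each other when every predicate has the same count on both; with the
    counts of the pieces abstracted this is linear arithmetic. *)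
Ltac count_solve f :=
  repeat progress rewrite ?(count_cat, count_rev, count_rcons) /=;
  repeat match goal with |- context [nat_of_bool (f ?z)] => generalize (nat_of_bool (f z)) end;
  repeat match goal with |- context [@count ?X f ?z] => generalize (@count X f z) end;
  clear; lia.

Ltac perm_solve := let f := fresh "f" in apply/permP => f; count_solve f.

Ltac perm_solve_with ps :=
  let f := fresh "f" in apply/permP => f; move/permP/(_ f): ps; count_solve f.

(** The extremal choice of the rotation arguments: the successor of the last occurrence fails
    [a]. *)
Lemma last_occurrence (T : Type) (a : pred T) (s : seq T) : has a s ->
  exists s1 z s2, [/\ s = s1 ++ z :: s2, a z & ~~ has a s2].
Proof.
elim: s => //= x s IH; case: (boolP (has a s)) => [/IH[s1 [z [s2 [-> az ns2]]]] _|ns].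
  by exists (x :: s1), z, s2.
by rewrite orbF => ax; exists [::], x, s.
Qed.

Section Graph.

Variables (T : finType) (e : rel T).
Hypothesis e_sym : symmetric e.
Hypothesis e_irr : irreflexive e.

Implicit Types (A C H S R V : {set T}) (s t p q : seq T) (u v w x y z : T).

(** * Components and separations *)

(** For S inside A these are the unions of components of G[A]. S may stick out of A, so that one
    closed set serves for several A. *)
Definition closed_in A S := forall x y, x \in S -> y \in A -> e x y -> y \in S.

Lemma closed_inD A S : closed_in A S -> closed_in A (A :\: S).
Proof.
move=> cS s t; rewrite !inE => /andP[sS sA] tA est; rewrite tA andbT.
by apply: contra sS => tS; apply: (cS t s) => //; rewrite e_sym.
Qed.

Lemma components_equiv A : {in A & &, equivalence_rel (connect (induced e A))}.
Proof.
move=> x y z _ _ _; split=> [|cxy]; first exact: connect0.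
suff csym : connect_sym (induced e A) by rewrite (same_connect csym cxy).
by apply: sym_connect_sym => a b; rewrite /induced /= e_sym; case: (a \in A); case: (b \in A).
Qed.

Lemma components_part A : partition (components e A) A.
Proof. exact/equivalence_partitionP/components_equiv. Qed.

Lemma mem_component A x y : x \in A -> y \in A ->
  (y \in component_of e A x) = connect (induced e A) x y.
Proof. exact: (pblock_equivalence_partition (@components_equiv A)). Qed.

Lemma component_self A x : x \in A -> x \in component_of e A x.
Proof.
by move=> xA; rewrite mem_pblock (cover_partition (components_part A)).
Qed.

Lemma component_in A x : x \in A -> component_of e A x \in components e A.
Proof.
by move=> xA; apply: pblock_mem; rewrite (cover_partition (components_part A)).
Qed.

Lemma component_unique A C x : C \in components e A -> x \in C ->
  C = component_of e A x.
Proof.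
case/and3P: (components_part A) => _ tr _ CA xC.
by rewrite /component_of (def_pblock tr CA xC).
Qed.

Lemma component_sub A C : C \in components e A -> C \subset A.
Proof.
by move=> CA; rewrite -(cover_partition (components_part A)); apply: bigcup_sup.
Qed.

Lemma component_ex A C : C \in components e A -> exists x, x \in C.
Proof.
case/and3P: (components_part A) => _ _ n0 CA; apply/set0Pn.
by apply: contraNneq n0 => <-.
Qed.

Lemma component_closed A C : C \in components e A -> closed_in A C.
Proof.
move=> CA s t sC tA est; have sA := subsetP (component_sub CA) _ sC.
rewrite (component_unique CA sC) mem_component //.
by apply: connect1; rewrite /induced /= sA tA est.
Qed.

Lemma component_min A C S x : C \in components e A -> closed_in A S ->
  x \in C -> x \in S -> C \subset S.
Proof.
move=> CA cS xC xS; apply/subsetP => y yC.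
have [xA yA] := (subsetP (component_sub CA) _ xC, subsetP (component_sub CA) _ yC).
have : connect (induced e A) x y.
  by rewrite -mem_component // -(component_unique CA xC).
case/connectP=> p pth ->; elim: p x xS pth {xC xA} => //= z p IH x xS.
by rewrite {1}/induced /= => /andP[/andP[/andP[_ zA] exz]]; apply: IH; apply: cS exz.
Qed.

Lemma component_meet A S x y : closed_in A S -> x \in S -> x \in A -> y \in A ->
  y \notin S -> component_of e A x != component_of e A y.
Proof.
move=> cS xS xA yA; apply: contraNneq => eq_xy.
apply: (subsetP (component_min (component_in xA) cS (component_self xA) xS)).
by rewrite eq_xy component_self.
Qed.

Lemma disconnectedP A :
  reflect (exists S x y, [/\ closed_in A S, S \subset A, x \in S, y \in A & y \notin S])
          (disconnected e A).
Proof.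
apply: (iffP card_gt1P) => [[C [D [CA DA nCD]]]|[S [x [y [cS SA xS yA yS]]]]].
  have [x xC] := component_ex CA; have [y yD] := component_ex DA.
  exists C, x, y; split=> //; first exact: component_closed.
  - exact: component_sub.
  - exact: (subsetP (component_sub DA)).
  by apply: contra nCD => yC; rewrite (component_unique CA yC) (component_unique DA yD).
have xA := subsetP SA _ xS.
exists (component_of e A x), (component_of e A y).
by rewrite !component_in // (component_meet cS).
Qed.

(** Unlike [connected] this holds of the empty set, so segments of paths and vertex-deleted sets
    need no non-emptiness condition. *)
Definition nd A := ~~ disconnected e A.

Lemma ndE A S x y : nd A -> closed_in A S -> x \in S -> x \in A -> y \in A -> y \in S.
Proof.
move=> /disconnectedP ndA cS xS xA yA; apply/negPn/negP => yS; apply: ndA.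
exists (S :&: A), x, y; split=> //; rewrite ?subsetIr ?inE ?xS ?yA ?andbT //.
by move=> s t; rewrite !inE => /andP[sS _] tA est; rewrite tA (cS s).
Qed.

Lemma component_nd A C : C \in components e A -> nd C.
Proof.
move=> CA; apply/disconnectedP => -[S [x [y [cS SC xS yC]]]].
apply/negP/negPn; apply: (subsetP _ _ yC); apply: (component_min CA _ _ xS).
  move=> s t sS tA est; apply: (cS s) => //.
  by apply: (component_closed CA _ tA est); apply: (subsetP SC).
exact: (subsetP SC).
Qed.

Lemma nd_component A C S : C \in components e A -> nd S -> S \subset A ->
  ~~ [disjoint S & C] -> S \subset C.
Proof.
move=> CA ndS SA /pred0Pn[x /= /andP[xS xC]]; apply/subsetP => y yS.
apply: (ndE ndS _ xC) => // s t sC tS; apply: (component_closed CA sC).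
exact: (subsetP SA).
Qed.

Lemma components_ge3 A S R x y z :
  closed_in A S -> closed_in A R -> x \in S -> y \in R -> z \in A ->
  x \in A -> y \in A -> y \notin S -> z \notin S -> z \notin R ->
  3 <= #|components e A|.
Proof.
move=> cS cR xS yR zA xA yA yS zS zR; rewrite cardE.
have -> : 3 = size [:: component_of e A x; component_of e A y; component_of e A z] by [].
apply: uniq_leq_size; last first.
  by move=> D; rewrite !inE mem_enum => /or3P[]/eqP->; apply: component_in.
rewrite /= !inE negb_or (component_meet cS xS xA yA yS).
by rewrite (component_meet cS xS xA zA zS) (component_meet cR yR yA zA zR).
Qed.

(** Each component contains all of S or all of R, whichever it meets; among three components two
    would contain the same one. *)
Lemma components_le2 A S R : nd S -> nd R -> A = S :|: R -> #|components e A| <= 2.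
Proof.
move=> ndS ndR defA; rewrite leqNgt.
have inS S' C x : C \in components e A -> nd S' -> S' \subset A -> x \in S' ->
    x \in C -> S' \subset C.
  by move=> CA nS sS xS xC; apply: (nd_component CA) => //; apply/pred0Pn; exists x; rewrite /= xS.
have [SA RA] : S \subset A /\ R \subset A by rewrite defA subsetUl subsetUr.
(* The vertex x records that the contained part is non-empty; otherwise the inclusion would not
   determine C. *)
have main C : C \in components e A ->
    [exists x in S, S \subset C] || [exists x in R, R \subset C].
  move=> CA; have [x xC] := component_ex CA.
  have := subsetP (component_sub CA) _ xC; rewrite {1}defA inE => /orP[xS|xR].
    by apply/orP; left; apply/exists_inP; exists x => //; apply: inS xC.
  by apply/orP; right; apply/exists_inP; exists x => //; apply: inS xC.
have same S' C D : C \in components e A -> D \in components e A ->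
    [exists x in S', S' \subset C] -> [exists x in S', S' \subset D] -> C = D.
  move=> CA DA /exists_inP[x xS /subsetP sC] /exists_inP[_ _ /subsetP sD].
  by rewrite (component_unique CA (sC _ xS)) (component_unique DA (sD _ xS)).
apply/card_gt2P => -[C1 [C2 [C3 [[c1 c2 c3] [/eqP n12 /eqP n23 /eqP n31]]]]].
case/orP: (main _ c1) (main _ c2) (main _ c3) => h1 /orP[] h2 /orP[] h3.
all: try by apply: n12; apply: same h1 h2.
all: try by apply: n23; apply: same h2 h3.
all: by apply: n31; apply: same h3 h1.
Qed.

(** * Paths through a given list of vertices *)

(* Spanning the list s up to permutation, rather than a set, makes concatenation free
   of disjointness conditions. *)
Definition ham s u v := exists p, [/\ path e u p, perm_eq (u :: p) s & last u p = v].

Lemma ham_perm s t u v : ham s u v -> perm_eq s t -> ham t u v.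
Proof. by case=> p [pth eqs lst] st; exists p; split=> //; apply: perm_trans st. Qed.

Lemma ham_path u p : path e u p -> ham (u :: p) u (last u p).
Proof. by exists p. Qed.

Lemma ham1 u : ham [:: u] u u.
Proof. by exists [::]. Qed.

Lemma ham_rev s u v : ham s u v -> ham s v u.
Proof.
case=> p [pth eqs lst]; exists (rev (belast u p)); rewrite -lst; split.
- by rewrite rev_path (eq_path (e' := e)) // => x y; rewrite /= e_sym.
- rewrite -rev_rcons -lastI perm_sym; apply: (perm_trans _ (_ : perm_eq (u :: p) _)).
    by rewrite perm_sym.
  by rewrite perm_sym perm_rev.
by case: p {pth eqs lst} => //= a p; rewrite rev_cons last_rcons.
Qed.

Lemma ham_cat s t u v w z : ham s u v -> e v w -> ham t w z -> ham (s ++ t) u z.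
Proof.
case=> p [pth eqs <-] evw [q [qth eqt <-]]; exists (p ++ w :: q).
by rewrite cat_path /= pth evw qth -cat_cons perm_cat // last_cat.
Qed.

Lemma ham_cons s u w z : e u w -> ham s w z -> ham (u :: s) u z.
Proof. exact: ham_cat (ham1 u). Qed.

Lemma ham_mem s u v : ham s u v -> (u \in s) && (v \in s).
Proof.
by case=> p [_ eqs <-]; rewrite -!(perm_mem eqs) mem_head mem_last.
Qed.

(** The suffix remains a raw [path] so that it can be split again. *)
Lemma path_split u p s x t : path e u p -> u :: p = s ++ x :: t ->
  [/\ ham (rcons s x) u x, path e x t & last x t = last u p].
Proof.
case: s => [|a s] pth [eq_u eq_p]; subst u p; first by split=> //; apply: (ham1 x).
move: pth; rewrite cat_path /= => /and3P[p1 e1 p2]; split=> //; last by rewrite last_cat.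
have := @ham_path a (rcons s x); rewrite last_rcons rcons_path p1; exact.
Qed.

Definition clique_seq s := {in s &, forall x y, x != y -> e x y}.

Lemma clique_path u p : uniq (u :: p) -> clique_seq (u :: p) -> path e u p.
Proof.
elim: p u => //= v p IH u /andP[uvp uq] cl; rewrite cl ?inE ?eqxx ?orbT //=.
  by apply: IH => // x y xs ys; apply: cl; rewrite inE (xs, ys) orbT.
by move: uvp; rewrite inE negb_or => /andP[].
Qed.

Lemma ham_clique s u v : uniq s -> clique_seq s -> u \in s -> v \in s -> u != v ->
  ham s u v.
Proof.
move=> uq cl us vs nuv.
have ps : perm_eq (u :: rcons (rem v (rem u s)) v) s.
  rewrite perm_sym; apply: perm_trans (perm_to_rem us) _; rewrite perm_cons.
  rewrite perm_sym perm_rcons perm_sym perm_to_rem //.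
  by rewrite mem_rem_uniq // !inE eq_sym nuv.
exists (rcons (rem v (rem u s)) v); split; rewrite ?last_rcons //.
apply: clique_path; first by rewrite (perm_uniq ps).
by move=> x y; rewrite !(perm_mem ps); apply: cl.
Qed.

Lemma clique_start s u : uniq s -> clique_seq s -> u \in s -> exists v, ham s u v.
Proof.
move=> uq cl us; have [/hasP[v vs nuv]|nh] := boolP (has (predC1 u) s).
  by exists v; apply: ham_clique => //; rewrite eq_sym.
exists u; apply: (ham_perm (ham1 u)).
rewrite perm_sym; apply: uniq_perm => // z; rewrite inE.
apply/idP/eqP => [zs|-> //]; apply/eqP/negPn; exact: (hasPn nh).
Qed.

Lemma clique_enter s u a : uniq s -> clique_seq s -> u \in s -> {in s, forall z, e a z} ->
  exists2 z, e a z & ham s z u.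
Proof.
move=> uq cl us ca; have [v hv] := clique_start uq cl us.
by exists v; [apply: ca; case/andP: (ham_mem hv)|apply: ham_rev].
Qed.

(* C turns out to be a clique with no edge to b, and any two vertices nonadjacent to b
   (resp. c) are adjacent. If c has no neighbour in B, then B is a clique with no edge
   to C and a is complete to B or to C, so that clique can be inserted right after a.
   Otherwise b' is the only neighbour of c in B, and B minus b' plays the role of B. *)
Lemma detour_absorb (A B C D pB pC : seq T) x y u a b b' c w d1 d2 :
    uniq (A ++ x :: B ++ y :: C ++ D) ->
    ham A u a -> e a x -> e x b -> B = b :: pB -> path e b pB -> last b pB = b' -> e b' y ->
    e y c -> C = c :: pC -> path e c pC -> last c pC = w ->
    ham D d1 d2 -> e x d1 -> e d2 y ->
    (forall z1 z2 z3, z1 \in A ++ B ++ C -> z2 \in A ++ B ++ C -> z3 \in A ++ B ++ C ->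
       uniq [:: z1; z2; z3] -> [|| e z1 z2, e z1 z3 | e z2 z3]) ->
  ~ (forall w', ~ ham (A ++ x :: B ++ y :: C ++ D) u w').
Proof.
move=> uW hA ax xb defB pthB lB b'y yc defC pthC lC hD xd1 d2y K nh.
have hB : ham B b b' by rewrite defB -lB; apply: ham_path.
have hC : ham C c w by rewrite defC -lC; apply: ham_path.
have [bB b'B] := andP (ham_mem hB); have [cC wC] := andP (ham_mem hC).
have [uA aA] := andP (ham_mem hA).
(* This reaches y with only B and C left, so no neighbour of y may start a spanning path of B and
   C. *)
have hAxDy : ham (A ++ x :: D ++ [:: y]) u y.
  exact: ham_cat hA ax (ham_cons xd1 (ham_cat hD d2y (ham1 y))).
have hAbad s v w' : ham s v w' -> e y v -> perm_eq s (B ++ C) -> False.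
  move=> hs yv ps; apply: (nh w'); apply: (ham_perm (ham_cat hAxDy yv hs)).
  by perm_solve_with ps.
have uABC : uniq (A ++ B ++ C).
  have : perm_eq (A ++ x :: B ++ y :: C ++ D) ((A ++ B ++ C) ++ x :: y :: D) by perm_solve.
  by move/perm_uniq; rewrite uW cat_uniq => /esym/andP[].
have [_ dA uBC] := and3P (etrans (esym (cat_uniq _ _)) uABC).
move: uBC; rewrite cat_uniq => /and3P[uB dBC uC].
have neq_AB z z' : z \in A -> z' \in B -> z != z'.
  by move=> zA zB; apply: contraNneq dA => eqz; apply/hasP; exists z'; rewrite ?mem_cat ?zB //= -eqz.
have neq_AC z z' : z \in A -> z' \in C -> z != z'.
  by move=> zA zB; apply: contraNneq dA => eqz; apply/hasP; exists z'; rewrite ?mem_cat ?zB ?orbT //= -eqz.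
have neq_BC z z' : z \in B -> z' \in C -> z != z'.
  by move=> zA zB; apply: contraNneq dBC => eqz; apply/hasP; exists z'; rewrite //= -eqz.
have KB z1 z2 z : z1 \in B -> z2 \in B -> z \in C -> z1 != z2 -> ~~ e z1 z -> ~~ e z2 z -> e z1 z2.
  move=> h1 h2 h n12 ne1 ne2; have := K z1 z2 z; rewrite !mem_cat h1 h2 h !orbT (negPf ne1) (negPf ne2) /= !inE negb_or n12 (neq_BC _ _ h1 h) (neq_BC _ _ h2 h) !orbF.
  by apply.
have KC z1 z2 z : z1 \in C -> z2 \in C -> z \in B -> z1 != z2 -> ~~ e z z1 -> ~~ e z z2 -> e z1 z2.
  move=> h1 h2 h n12 ne1 ne2; have := K z z1 z2; rewrite !mem_cat h1 h2 h !orbT (negPf ne1) (negPf ne2) /= !inE negb_or n12 (neq_BC _ _ h h1) (neq_BC _ _ h h2).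
  by apply.
have KA z1 z2 z : z1 \in B -> z2 \in C -> z \in A -> ~~ e z1 z2 -> e z z1 || e z z2.
  move=> h1 h2 h ne; have := K z z1 z2; rewrite !mem_cat h1 h2 h !orbT (negPf ne) /= !inE negb_or (neq_BC _ _ h1 h2) (neq_AB _ _ h h1) (neq_AC _ _ h h2) orbF.
  by apply.
have nbc : ~~ e b c.
  by apply/negP => ebc; apply: (hAbad _ _ _ (ham_cat (ham_rev hB) ebc hC)); rewrite // e_sym.
(* Let z1 be the last neighbour of b in C. If z1 ends C, continue from y by c ... z1 b ... b'.
   Otherwise its successor z' is adjacent to c, and b' ... b z1 ... c z' ... w serves. *)
have nbC z : z \in C -> ~~ e b z.
  move=> zC0; apply/negP => ebz0; have /last_occurrence[C1 [z1 [C2 [eqC ebz nC2]]]] : has (e b) C.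
    by apply/hasP; exists z.
  have [hC1 pC2 lC2] := path_split pthC (etrans (esym defC) eqC).
  have yb' : e y b' by rewrite e_sym.
  case: C2 => [|z' C2] in eqC nC2 pC2 lC2.
    apply: (hAbad _ _ _ (ham_cat hC (_ : e w b) hB)) => //; last by perm_solve.
    by rewrite -lC -lC2 e_sym.
  have /andP[ezz' pz'] := pC2; have z'C : z' \in C by rewrite eqC mem_cat !inE eqxx !orbT.
  move: nC2; rewrite /= negb_or => /andP[nbz' _].
  have ncz' : c != z'.
    apply/eqP => cz'; move: uC; rewrite eqC cat_uniq => /and3P[_ /hasPn dj /andP[n _]].
    case: C1 => [|c1 C1] in eqC dj hC1; move: eqC; rewrite defC => -[cz _].
      by move: ebz; rewrite -cz (negPf nbc).
    by have := dj z'; rewrite !inE eqxx orbT -cz' cz eqxx => /(_ isT).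
  have ecz' : e c z' by apply: KC nbc nbz'.
  apply: (hAbad _ _ _ (ham_cat (ham_cat (ham_rev hB) ebz (ham_rev hC1)) ecz' (ham_path pz'))) => //.
  by rewrite eqC; perm_solve.
have clC : clique_seq C by move=> z1 z2 z1C z2C n12; apply: KC bB n12 _ _ => //; apply: nbC.
have toC z : {in C, forall z', e z z'} -> exists2 z', e z z' & ham C z' c.
  exact: clique_enter.
(* Otherwise: C right after a, ending at c, then y, D backwards, x and B. *)
have a_not_C : ~ {in C, forall z, e a z}.
  move=> /toC[z eaz hz].
  apply: (nh b'); apply: (ham_perm (ham_cat (ham_cat (ham_cat hA eaz hz) (_ : e c y) (ham_cons (_ : e y d2) (ham_cat (ham_rev hD) (_ : e d1 x) (ham1 x)))) xb hB)).
  - by rewrite e_sym.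
  - by rewrite e_sym.
  - by rewrite e_sym.
  by perm_solve.
(* B right after a, ending at b, then x, D, y and C. *)
have a_not_B s z : e a z -> ham s z b -> perm_eq s B -> False.
  move=> eaz hs ps; apply: (nh w).
  apply: (ham_perm (ham_cat (ham_cat hA eaz hs) (_ : e b x) (ham_cons xd1 (ham_cat hD d2y (ham_cons yc hC))))).
    by rewrite e_sym.
  by perm_solve_with ps.
have /allPn[z0 z0C naz0] : ~~ all (e a) C by apply/negP => /allP.
have aB z : z \in B -> ~~ e z z0 -> e a z.
  by move=> zB nzz0; have := KA z z0 a zB z0C aA nzz0; rewrite (negPf naz0) orbF.
(* After y, take b' ... z' b ... z c ... w. *)
have crossB B1 z z' B2 : B = B1 ++ z :: z' :: B2 -> e c z -> e b z' -> False.
  move=> eqB ecz ebz'; have [hB1 /andP[_ p2] lB2] := path_split pthB (etrans (esym defB) eqB).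
  have hz' : ham (z' :: B2) z' b' by rewrite -lB -lB2; apply: ham_path.
  apply: (hAbad _ _ _ (ham_cat (ham_cat (ham_rev hz') (_ : e z' b) hB1) (_ : e z c) hC)).
  - by rewrite e_sym.
  - by rewrite e_sym.
  - by rewrite e_sym.
  by rewrite eqB; perm_solve.
have nb_next B1 z z' B2 : B = B1 ++ z :: z' :: B2 -> b != z'.
  move=> eqB; have uB' := uB; rewrite eqB in uB'; rewrite defB in eqB.
  case: B1 eqB uB' => [|b1 B1] [<- _]; first by rewrite /= inE negb_or => /andP[/andP[]].
  by rewrite cat_cons cons_uniq mem_cat !inE !negb_or => /andP[/and4P[]].
have crossB' B1 z z' B2 : B = B1 ++ z :: z' :: B2 -> e c z -> ~~ e c z' -> False.
  move=> eqB ecz ncz'; have z'B : z' \in B by rewrite eqB mem_cat !inE eqxx !orbT.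
  apply: (crossB _ _ _ _ eqB ecz); apply: (KB _ _ c) => //; last by rewrite e_sym.
  exact: nb_next eqB.
have [/last_occurrence[B1 [z1 [B2 [eqB cz1 nB2]]]]|nBc] := boolP (has (e c) B); last first.
  have cB z : z \in B -> ~~ e z c by move=> zB; rewrite e_sym; apply: (hasPn nBc).
  have clB : clique_seq B by move=> z z' zB z'B n; apply: (KB _ _ c) => //; apply: cB.
  have nBC z z' : z \in B -> z' \in C -> ~~ e z z'.
    move=> zB z'C; apply/negP => zz'; have [v hv] := clique_start uB clB zB.
    have ncz' : c != z' by apply: contraNneq (cB _ zB) => ->.
    by apply: (hAbad _ _ _ (ham_cat (ham_clique uC clC cC z'C ncz') (_ : e z' z) hv)); rewrite // 1?e_sym //; perm_solve.
  have [z eaz hz] : exists2 z, e a z & ham B z b.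
    by apply: clique_enter => // z zB; apply: aB => //; apply: nBC.
  exact: a_not_B eaz hz (perm_refl _).
(* By [crossB'] the last neighbour of c in B has no successor in B, so it is b'. *)
case: B2 => [|z' B2] in eqB nB2; last first.
  by move: nB2; rewrite /= negb_or => /andP[ncz' _]; case: (crossB' _ _ _ _ eqB cz1 ncz').
have [_ _ /= lz1] := path_split pthB (etrans (esym defB) eqB).
have {lz1 nB2} z1b' : z1 = b' by rewrite lz1.
rewrite {z1}z1b' in eqB cz1.
case: B1 => [|b1 r] in eqB.
  by move: nbc; move: eqB; rewrite defB => -[-> _]; rewrite e_sym cz1.
have {b1 eqB} eqB : B = b :: rcons r b' by move: eqB; rewrite defB -cats1 => -[_ ->].
have uBr := uB; rewrite eqB -rcons_cons rcons_uniq in uBr.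
have /andP[b'0 uB0] := uBr.
have mB z : (z \in B) = (z \in b :: r) || (z == b') by rewrite eqB -rcons_cons mem_rcons inE orbC.
have B0B z : z \in b :: r -> z \in B by rewrite mB => ->.
have nb'0 z : z \in b :: r -> z != b' by move=> zr; apply: contraNneq b'0 => <-.
have b'_not_C : ~ {in C, forall z, e b' z}.
  move=> /toC[z eb'z hz].
  by apply: (hAbad _ _ _ (ham_cat (ham_rev hz) (_ : e z b') (ham_rev hB))); rewrite // 1?e_sym //; perm_solve.
(* Otherwise each z in C, being non-adjacent to b, would be adjacent to b'. *)
have ebb' : e b b'.
  apply: contraPT b'_not_C => nbb' k; apply: k => z zC.
  have := K b b' z; rewrite !mem_cat bB b'B zC !orbT (negPf nbb') (negPf (nbC _ zC)) /= => -> //.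
  by rewrite !inE negb_or nb'0 ?mem_head // !neq_BC.
(* Take the last neighbour of c before b'. If b' follows it, the edge b b' allows [crossB];
   otherwise [crossB'] applies. *)
have ncB0 z : z \in b :: r -> ~~ e z c.
  rewrite e_sym; apply/hasPn/negP => /last_occurrence[B1 [z1 [B2 [eqB0 ecz1 nB2]]]].
  case: B2 => [|z' B2] in eqB0 nB2.
    by apply: (crossB B1 z1 b' [::]) => //; rewrite eqB -rcons_cons eqB0 -cats1 -catA.
  apply: (crossB' B1 z1 z' (rcons B2 b')) => //.
    by rewrite eqB -rcons_cons eqB0 -!cats1 -catA.
  by move: nB2; rewrite /= negb_or => /andP[].
have clB0 : clique_seq (b :: r) by move=> z z' zB z'B n; apply: (KB _ _ c); rewrite ?B0B ?ncB0.
have nb'C z : z \in C -> z != c -> ~~ e b' z.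
  move=> zC nzc; apply/negP => eb'z.
  apply: (hAbad _ _ _ (ham_cat (ham_clique uC clC cC zC _) (_ : e z b') (ham_rev hB))) => //.
  - by rewrite eq_sym.
  - by rewrite e_sym.
  by perm_solve.
have nB0C z z' : z \in b :: r -> z' \in C -> ~~ e z z'.
  move=> zB z'C; apply/negP => zz'.
  have nzb : z != b by apply: contraTneq zz' => ->; apply: nbC.
  have ncz' : c != z' by apply: contraNneq (ncB0 _ zB) => ->.
  apply: (hAbad _ _ _ (ham_cat (ham_clique uC clC cC z'C ncz') (_ : e z' z)
    (ham_cat (ham_clique uB0 clB0 zB (mem_head _ _) nzb) ebb' (ham1 b')))) => //.
    by rewrite e_sym.
  by rewrite eqB; perm_solve.
have aB0 z : z \in b :: r -> e a z by move=> zB; apply: aB; rewrite ?B0B ?nB0C.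
have nxb' : r = [::] -> ~~ e a b'.
  move=> r0; apply/negP => ab'; apply: (a_not_B [:: b'; b] b' ab').
    by apply: ham_cons (ham1 b); rewrite e_sym.
  by rewrite eqB r0; perm_solve.
(* If B is b b', then a is not adjacent to b', hence is adjacent to all of C except perhaps c, and C
   goes after a, ending at c. If C is c alone, then b' is complete to C, which was excluded. *)
case: r => [|b1 r] in eqB mB uBr b'0 uB0 B0B nb'0 clB0 ncB0 nB0C aB0 nxb' *.
  have aC z : z \in C -> z != c -> e a z.
    move=> zC nzc; have := KA b' z a b'B zC aA (nb'C _ zC nzc).
    by rewrite (negPf (nxb' _)).
  have [/hasP[z zC nzc]|noz] := boolP (has (predC1 c) C).
    apply: (nh b'); apply: (ham_perm (ham_cat (ham_cat (ham_cat hA (aC z zC nzc)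
      (ham_clique uC clC zC cC nzc)) (_ : e c y) (ham_cons (_ : e y d2) (ham_cat (ham_rev hD) (_ : e d1 x) (ham1 x)))) xb hB)).
    - by rewrite e_sym.
    - by rewrite e_sym.
    - by rewrite e_sym.
    by perm_solve.
  by apply: b'_not_C => z zC; have /= := hasPn noz z zC; rewrite negbK => /eqP->; rewrite e_sym.
(* Now the vertices strictly between b and b' come right after a, ending at the predecessor z' of
   b', followed by b' and b. *)
pose z' := last b1 r.
have z'r : z' \in b1 :: r by apply: mem_last.
have ez'b' : e z' b'.
  have := pthB; have := eqB; rewrite {1}defB => -[->].
  by rewrite -rcons_cons rcons_path /= => /andP[].
have [z eaz hz] : exists2 z, e a z & ham (b1 :: r) z z'.
  apply: clique_enter => //; first by case/andP: uB0.
    by move=> v v' vr v'r; apply: clB0; rewrite inE (vr, v'r) orbT.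
  by move=> v vr; apply: aB0; rewrite inE vr orbT.
apply: (a_not_B _ _ eaz (ham_cat hz ez'b' (ham_cons (_ : e b' b) (ham1 b)))).
  by rewrite e_sym.
by rewrite eqB; perm_solve.
Qed.
(** * Longest paths and their attachments *)

Lemma nd_path H z1 z2 : nd H -> z1 \in H -> z2 \in H ->
  exists q, [/\ ham q z1 z2, uniq q & {subset q <= H}].
Proof.
move=> ndH z1H z2H.
have : z2 \in [set z | connect (induced e H) z1 z].
  apply: (ndE ndH _ _ z1H z2H); rewrite ?inE //.
  move=> x y; rewrite !inE => xc yH exy; have [<-//|nyz] := eqVneq z1 y.
  have xH : x \in H.
    case/connectP: xc => p; case/lastP: p => [_ -> //|p t].
    by rewrite rcons_path last_rcons => /andP[_ /andP[/andP[_ tH] _]] ->.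
  by apply: connect_trans xc (connect1 _); rewrite /induced /= xH yH.
rewrite inE => /connectP[p0 pth0 ->]; case/shortenP: pth0 => p pth up _.
have [pH pe] : {subset p <= H} /\ path e z1 p.
  elim: p z1 {p0 z1H up} pth => //= x p IH z1 /andP[/andP[/andP[_ xH] ex] /IH[sub pth]].
  by split; rewrite ?ex // => y; rewrite inE => /predU1P[->|/sub].
exists (z1 :: p); split=> //; first exact: ham_path.
by move=> y; rewrite inE => /predU1P[->|/pH].
Qed.

Lemma uniq_split s1 s2 t1 t2 x : uniq (s1 ++ x :: s2) ->
  s1 ++ x :: s2 = t1 ++ x :: t2 -> s1 = t1 /\ s2 = t2.
Proof.
move=> us eqs; have nx r1 r2 : uniq (r1 ++ x :: r2) -> index x (r1 ++ x :: r2) = size r1.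
  rewrite cat_uniq /= negb_or => /and3P[_ /andP[nx _] _].
  by rewrite index_cat (negPf nx) /= eqxx addn0.
have sz : size s1 = size t1 by rewrite -(nx s1 s2) // -(nx t1 t2) -?eqs.
by move/eqP: eqs; rewrite eqseq_cat // => /andP[/eqP-> /eqP[->]].
Qed.

(** The last two inequalities say that the pairs x b and y c do not overlap on P. *)
Lemma order_split P s1 x b s2 t1 y c t2 : uniq P ->
    P = s1 ++ x :: b :: s2 -> P = t1 ++ y :: c :: t2 -> x != y -> y != b -> x != c ->
  (exists r1 r2 r3, P = r1 ++ x :: b :: r2 ++ y :: c :: r3) \/
  (exists r1 r2 r3, P = r1 ++ y :: c :: r2 ++ x :: b :: r3).
Proof.
move=> uP eqx eqy nxy nyb nxc.
have : y \in s1 ++ x :: b :: s2 by rewrite -eqx eqy mem_cat mem_head orbT.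
rewrite mem_cat !inE [y == x]eq_sym (negPf nxy) (negPf nyb) /= => /orP[] ys.
  case/splitPr: ys eqx => r1 r2 eqx.
  right; rewrite -catA cat_cons in eqx; have uP' := uP; rewrite eqx in uP'.
  have [_] := uniq_split uP' (etrans (esym eqx) eqy).
  case: r2 eqx {uP'} => [|c' r2] eqx [] c'c _; first by rewrite c'c eqxx in nxc.
  by exists r1, r2, s2; rewrite eqx c'c.
case/splitPr: ys eqx => r1 r2 eqx; left.
have eqx' : P = (s1 ++ x :: b :: r1) ++ y :: r2 by rewrite eqx -catA.
have uP' := uP; rewrite eqx' in uP'.
have [_ eqr] := uniq_split uP' (etrans (esym eqx') eqy).
by exists s1, r1, t2; rewrite eqx eqr.
Qed.

Definition gpath V u p := [&& path e u p, uniq (u :: p) & all (mem V) (u :: p)].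

(** Kept general because paths are maximised with a fixed start, with both ends fixed, and with free
    ends. *)
Lemma ex_longest (good : pred (seq T)) p0 : (forall p, good p -> uniq p) -> good p0 ->
  exists2 p, good p & forall q, good q -> size q <= size p.
Proof.
move=> gu g0; pose Pn n := [exists t : n.-tuple T, good t].
have exP : exists n, Pn n by exists (size p0); apply/existsP; exists (in_tuple p0).
have ub n : Pn n -> n <= #|T|.
  by case/existsP=> t /gu /card_uniqP; rewrite size_tuple => <-; apply: max_card.
case: (ex_maxnP exP ub) => n /existsP[t gt] mx; exists t => // q gq.
by rewrite size_tuple; apply: mx; apply/existsP; exists (in_tuple q).
Qed.

Lemma ham_gpath V Q u w : ham Q u w -> uniq Q -> {subset Q <= V} ->
  exists q, [/\ gpath V u q, last u q = w & (size q).+1 = size Q].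
Proof.
case=> q [pth pq lq] uQ QV; exists q; split; rewrite // -?(perm_size pq) //.
rewrite /gpath pth (perm_uniq pq) uQ; apply/allP => z.
by rewrite (perm_mem pq); apply: QV.
Qed.

Definition rest (P : seq T) V h : {set T} := component_of e (V :\: [set z in P]) h.
(** Membership of x in P is not part of this and is carried separately. *)
Definition attached (P : seq T) V h x := [exists z in rest P V h, e x z].

Section Attachments.

Variables (V : {set T}) (P : seq T) (h : T).
Hypotheses (hV : h \in V) (hP : h \notin P).

Let hR : h \in V :\: [set z in P]. Proof. by rewrite !inE hP. Qed.

Lemma rest_self : h \in rest P V h. Proof. exact: component_self hR. Qed.

Lemma rest_sub z : z \in rest P V h -> (z \in V) && (z \notin P).
Proof. by move/(subsetP (component_sub (component_in hR))); rewrite !inE andbC. Qed.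

Lemma not_attached x : ~~ attached P V h x -> ~~ e h x.
Proof. by apply: contra => ehx; apply/exists_inP; exists h; [apply: rest_self|rewrite e_sym]. Qed.

(** With W equal to V minus a few vertices this produces an attachment different from these. Without
    one, the component of h would be closed in W and contain z. *)
Lemma attached_in (W : {set T}) z : W \subset V -> nd W -> h \in W -> z \in W -> z \in P ->
  exists y, [/\ y \in P, y \in W & attached P V h y].
Proof.
move=> WV ndW hW zW zP.
have [/hasP[y yP /andP[yW ya]]|no] := boolP (has (fun y => (y \in W) && attached P V h y) P).
  by exists y.
suff : z \in rest P V h by move/rest_sub; rewrite zP andbF.
apply: (ndE ndW _ rest_self hW zW) => x y xH yW exy.
have yV := subsetP WV _ yW; have [yP|yP] := boolP (y \in P).
  move/hasPn/(_ _ yP): no; rewrite yW => /existsPn/(_ x).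
  by rewrite xH e_sym exy.
by apply: (component_closed (component_in hR) xH _ exy); rewrite !inE yP.
Qed.

(** The equation on [uniq] says, for duplicate-free P, that D is duplicate-free and avoids P. The
    case x = y is used to append a detour at an end of P. *)
Lemma detour x y : attached P V h x -> attached P V h y ->
  exists D d1 d2, [/\ ham D d1 d2, uniq (P ++ D) = uniq P, {subset D <= V}, e x d1 & e d2 y].
Proof.
case/exists_inP=> d1 d1H xd1 /exists_inP[d2 d2H yd2].
have [D [hD uD sD]] := nd_path (component_nd (component_in hR)) d1H d2H.
exists D, d1, d2; split=> //; last by rewrite e_sym.
  rewrite cat_uniq uD andbT; apply/andb_idr => _; apply/hasPn => z /sD/rest_sub/andP[_ //].
by move=> z /sD/rest_sub/andP[].
Qed.

End Attachments.

(** * Successors of attachments on a longest path *)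

Section LongestFixedEnds.

Variables (V : {set T}) (u : T) (p : seq T) (h : T).
Hypotheses (gp : gpath V u p) (hV : h \in V) (hP : h \notin u :: p).
Hypothesis longest : forall q, gpath V u q -> last u q = last u p -> size q <= size p.

Let P := u :: p.
Let att := attached P V h.

Let pth : path e u p. Proof. by case/and3P: gp. Qed.
Let uP : uniq P. Proof. by case/and3P: gp. Qed.
Let PV : {subset P <= V}. Proof. by case/and3P: gp => _ _ /allP. Qed.

(** Maximality is assumed only among paths with the same two ends, so that the consequences also
    serve when both ends are prescribed. *)
Lemma no_longer D d1 d2 Q : ham D d1 d2 -> uniq (P ++ D) = uniq P -> {subset D <= V} ->
  perm_eq Q (P ++ D) -> ham Q u (last u p) -> False.
Proof.
move=> hD uPD DV pQ hQ.
have QV : {subset Q <= V}.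
  by move=> z; rewrite (perm_mem pQ) mem_cat => /orP[/PV|/DV].
have [|q [gq lq sq]] := ham_gpath hQ _ QV; first by rewrite (perm_uniq pQ) uPD.
have := longest gq lq; suff : size P < size Q by rewrite -sq /=; clear; lia.
rewrite (perm_size pQ) size_cat; case: (hD) => [r [_ /perm_size <- _]] /=; clear; lia.
Qed.

Lemma attached_consec s1 x b s2 : P = s1 ++ x :: b :: s2 -> att x -> ~~ att b.
Proof.
move=> eqP ax; apply/negP => ab.
have [D [d1 [d2 [hD uD DV xd1 d2b]]]] := detour hV hP ax ab.
have [h1 /andP[_ p2] l2] := path_split pth eqP.
apply: (no_longer hD uD DV _ (_ : ham ((rcons s1 x ++ D) ++ b :: s2) u _)).
  by rewrite eqP; perm_solve.
by apply: ham_cat (ham_cat h1 xd1 hD) d2b _; rewrite -l2; apply: ham_path.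
Qed.

(** Otherwise go from x through D to y, back along P to b, over the edge b c, and on to the end. *)
Lemma attached_cross r1 x b r2 y c r3 : P = r1 ++ x :: b :: r2 ++ y :: c :: r3 ->
  att x -> att y -> ~~ e b c.
Proof.
move=> eqP ax ay; apply/negP => ebc.
have [D [d1 [d2 [hD uD DV xd1 d2y]]]] := detour hV hP ax ay.
have [h1 /andP[_ p2] l2] := path_split pth eqP.
have [h3 /andP[eyc p4] l4] := path_split (s := b :: r2) p2 (erefl _).
apply: (no_longer hD uD DV _ (_ : ham ((rcons r1 x ++ D) ++ rcons (b :: r2) y ++ c :: r3) u _)).
  by rewrite eqP; perm_solve.
have hC : ham (c :: r3) c (last u p) by rewrite -l2 /= -l4; apply: ham_path.
exact: ham_cat (ham_cat h1 xd1 hD) d2y (ham_cat (ham_rev h3) ebc hC).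
Qed.

Lemma next_split x : x \in P -> x != last u p -> exists s1 b s2, P = s1 ++ x :: b :: s2.
Proof.
rewrite -[last u p]/(last u P) => /splitPr[s1 [|b s2]]; last by exists s1, b, s2.
by rewrite last_cat /= eqxx.
Qed.

(** Successors of attachments are not attached, so the two pairs do not overlap and [attached_cross]
    applies in one of the two orders. *)
Lemma next_indep s1 x b s2 t1 y c t2 : P = s1 ++ x :: b :: s2 -> P = t1 ++ y :: c :: t2 ->
  att x -> att y -> x != y -> [/\ b != c, ~~ e b c, ~~ att b & ~~ att c].
Proof.
move=> eqx eqy ax ay nxy.
have [nab nac] := (attached_consec eqx ax, attached_consec eqy ay).
have nyb : y != b by apply: contraNneq nab => <-.
have nxc : x != c by apply: contraNneq nac => <-.
have main r1 x' b' r2 y' c' r3 : P = r1 ++ x' :: b' :: r2 ++ y' :: c' :: r3 -> b' != c'.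
  move=> eqP; move: uP; rewrite eqP cat_uniq /= !inE !mem_cat !inE !negb_or.
  by case/and5P=> _ _ _ /and4P[].
have [[r1 [r2 [r3 eqP]]]|[r1 [r2 [r3 eqP]]]] := order_split uP eqx eqy nxy nyb nxc.
  by rewrite (main _ _ _ _ _ _ _ eqP) (attached_cross eqP).
by rewrite eq_sym (main _ _ _ _ _ _ _ eqP) e_sym (attached_cross eqP).
Qed.

End LongestFixedEnds.

Section LongestFixedStart.

Variables (V : {set T}) (u : T) (p : seq T).
Hypothesis gp : gpath V u p.
Hypothesis longest : forall q, gpath V u q -> size q <= size p.

Let P := u :: p.

Lemma no_longer_start D d1 d2 Q w : ham D d1 d2 -> uniq (P ++ D) = uniq P ->
  {subset D <= V} -> perm_eq Q (P ++ D) -> ham Q u w -> False.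
Proof.
have [_ uP /allP PV] := and3P gp.
move=> hD uPD DV pQ hQ.
have QV : {subset Q <= V}.
  by move=> z; rewrite (perm_mem pQ) mem_cat => /orP[/PV|/DV].
have [|q [gq lq sq]] := ham_gpath hQ _ QV; first by rewrite (perm_uniq pQ) uPD.
have := longest gq; suff : size P < size Q by rewrite -sq /=; clear; lia.
rewrite (perm_size pQ) size_cat; case: (hD) => [r [_ /perm_size <- _]] /=; clear; lia.
Qed.

(** A detour at the last vertex could be appended. *)
Lemma attached_not_last h x : h \in V -> h \notin P -> attached P V h x -> x != last u p.
Proof.
move=> hV hP ax; apply/eqP => xl; have [pth _ _] := and3P gp.
have [D [d1 [d2 [hD uD DV xd1 _]]]] := detour hV hP ax ax.
by apply: (no_longer_start hD uD DV (perm_refl _) (ham_cat (ham_path pth) _ hD)); rewrite -xl.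
Qed.

End LongestFixedStart.

(** * Sets of independence number at most 2 *)

Definition triple_free (s : {pred T}) := forall x y z, x \in s -> y \in s -> z \in s ->
  uniq [:: x; y; z] -> [|| e x y, e x z | e y z].

Lemma triple_freeP (s : {pred T}) x y z : triple_free s -> x \in s -> y \in s -> z \in s ->
  x != y -> x != z -> ~~ e x y -> ~~ e x z -> y != z -> e y z.
Proof.
move=> K xs ys zs nxy nxz nexy nexz nyz; have := K x y z xs ys zs.
by rewrite (negPf nexy) (negPf nexz) /= !inE negb_or nxy nxz nyz => ->.
Qed.

Lemma gpath_cover V u p : gpath V u p ->
  ham (enum V) u (last u p) \/ exists2 h, h \in V & h \notin u :: p.
Proof.
case/and3P=> pth up /allP pV.
have [/existsP[h /andP[hV hp]]|nh] := boolP [exists h, (h \in V) && (h \notin u :: p)].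
  by right; exists h.
left; exists p; split=> //; apply: uniq_perm; rewrite ?enum_uniq // => z; rewrite mem_enum.
apply/idP/idP => [/pV //|zV].
by move: nh; rewrite negb_exists => /forallP/(_ z); rewrite zV negbK.
Qed.

(* If a component of V - P is attached to x and y on P, it has a vertex h which,
   with the successors of x and y on P, would form an independent triple. *)
Lemma attached_pair V u p h x y : triple_free (mem V) -> gpath V u p -> h \in V -> h \notin u :: p ->
    (forall q, gpath V u q -> last u q = last u p -> size q <= size p) ->
    attached (u :: p) V h x -> attached (u :: p) V h y -> x \in u :: p -> y \in u :: p ->
  x != last u p -> y != last u p -> x = y.
Proof.
move=> K gp hV hP lng ax ay xP yP xl yl; apply/eqP/negPn/negP => nxy.
have [_ _ /allP pV] := and3P gp.
have [s1 [b [s2 eqP]]] := next_split xP xl; have [t1 [c [t2 eqP']]] := next_split yP yl.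
have [nbc nebc nab nac] := next_indep gp hV hP lng eqP eqP' ax ay nxy.
have bP : b \in u :: p by rewrite eqP mem_cat !inE eqxx !orbT.
have cP : c \in u :: p by rewrite eqP' mem_cat !inE eqxx !orbT.
move/negP: nebc; apply; apply: (triple_freeP K hV (pV _ bP) (pV _ cP)) => //.
- by apply: contraNneq hP => ->.
- by apply: contraNneq hP => ->.
- exact: (not_attached hV hP nab).
exact: (not_attached hV hP nac).
Qed.

(** A longest path from u missing h has a single attachment x. If x = u, connectedness of V minus u
    gives another one. Otherwise h has no neighbour in P minus x, which is thus a clique: run
    through it from u to the successor of x, then take x and the detour. *)
Lemma triple_free_ham V u : triple_free (mem V) -> u \in V -> nd V -> nd (V :\ u) ->
  exists w, ham (enum V) u w.
Proof.
move=> K uV ndV ndVu.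
have g0 : gpath V u [::] by rewrite /gpath /= uV.
have [p|p gp lng] := ex_longest _ g0; first by case/and3P=> _ /andP[].
have [|[h hV hP]] := gpath_cover gp; first by exists (last u p).
exfalso; have lng' q (gq : gpath V u q) (_ : last u q = last u p) := lng q gq.
have [pth up /allP pV0] := and3P gp; have pV : {subset u :: p <= V} := pV0.
have nxl y := @attached_not_last V u p gp lng h y hV hP.
have [x [xP xV ax]] := attached_in hV hP (subxx V) ndV hV uV (mem_head u p).
have [s1 [b [s2 eqP]]] := next_split xP (nxl _ ax).
have xonly y : y \in u :: p -> attached (u :: p) V h y -> y = x.
  by move=> yP ay; apply: (attached_pair K gp hV hP lng' ay ax yP xP (nxl _ ay) (nxl _ ax)).
have bP : b \in u :: p by rewrite eqP mem_cat !inE eqxx !orbT.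
have nxb : b != x.
  by move: up; rewrite eqP uniq_catC /= inE negb_or eq_sym => /andP[/andP[]].
have [xu|nxu] := eqVneq x u.
  have [||y [yP yVu ay]] := attached_in hV hP (subsetDl V [set u]) ndVu _ _ bP.
  - by rewrite !inE hV andbT; apply: contraNneq hP => ->; apply: mem_head.
  - by rewrite !inE -xu nxb pV.
  by rewrite -xu (xonly _ yP ay) !inE eqxx in yVu.
have us : uniq (s1 ++ b :: s2).
  have : perm_eq (u :: p) (x :: (s1 ++ b :: s2)) by rewrite eqP; perm_solve.
  by move/perm_uniq; rewrite up => /esym/andP[].
have sP z : z \in s1 ++ b :: s2 -> [/\ z \in u :: p & z != x].
  move=> zs; have pe : perm_eq (u :: p) (x :: (s1 ++ b :: s2)) by rewrite eqP; perm_solve.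
  split; first by rewrite (perm_mem pe) inE zs orbT.
  move: up; rewrite (perm_uniq pe) /= => /andP[xs _].
  by apply: contraNneq xs => <-.
have hz z : z \in s1 ++ b :: s2 -> [/\ z \in V, h != z & ~~ e h z].
  move=> /sP[zP nzx]; split; first exact: pV.
    by apply: contraNneq hP => ->.
  by apply: (not_attached hV hP); apply: contraNN nzx => /(xonly _ zP) ->.
have cl : clique_seq (s1 ++ b :: s2).
  by move=> y z /hz[yV hy hey] /hz[zV hz' hez]; apply: triple_freeP K hV yV zV _ _ _ _.
have us1 : u \in s1 ++ b :: s2.
  case: s1 eqP {us sP hz cl} => [|a s1] [eu _]; first by rewrite eu eqxx in nxu.
  by rewrite eu mem_head.
have bs : b \in s1 ++ b :: s2 by rewrite mem_cat mem_head orbT.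
have nub : u != b.
  apply: contraTneq up => ub; case: s1 eqP {us sP hz cl us1 bs} => [|a s1] [eu ep].
    by rewrite eu eqxx in nxu.
  by rewrite /= ep ub mem_cat !inE eqxx !orbT.
have [D [d1 [d2 [hD uD DV xd1 _]]]] := detour hV hP ax ax.
have ebx : e b x.
  by have [_ /andP[exb _] _] := path_split pth eqP; rewrite e_sym.
have hQ := ham_cat (ham_clique us cl us1 bs nub) ebx (ham_cons xd1 hD).
have pQ : perm_eq ((s1 ++ b :: s2) ++ x :: D) ((u :: p) ++ D) by rewrite eqP; perm_solve.
exact: (no_longer_start gp lng hD uD DV pQ hQ).
Qed.

Lemma gpath_rev V u p : gpath V u p ->
  exists2 q, gpath V (last u p) q & last (last u p) q = u /\ perm_eq (last u p :: q) (u :: p).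
Proof.
case/and3P=> pth up pV; have [q [pq eqq lq]] := ham_rev (ham_path pth).
by exists q; rewrite /gpath ?pq ?lq ?(perm_uniq eqq) ?(perm_all _ eqq) ?up ?pV.
Qed.

Lemma attached_perm P Q V h : perm_eq P Q -> attached P V h =1 attached Q V h.
Proof.
move=> pq x; rewrite /attached /rest.
by have -> : [set z in P] = [set z in Q] by apply/setP => z; rewrite !inE (perm_mem pq).
Qed.

(** By [attached_pair] any two attachments include v, and on the reversed path they include u. So u
    and v are the only attachments, and removing them separates h from the successor of u. *)
Lemma triple_free_ham_ends V u v : triple_free (mem V) -> u \in V -> v \in V -> u != v ->
    nd V -> (forall x, x \in V -> nd (V :\ x)) -> nd (V :\: [set u; v]) ->
  ham (enum V) u v.
Proof.
move=> K uV vV nuv ndV ndVx ndVuv.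
have [s [hs us sV]] := nd_path ndV uV vV.
have [p0 [g0 l0 _]] := ham_gpath hs us sV.
have [p||p /andP[gp /eqP lp] lng] :=
    @ex_longest (fun p => gpath V u p && (last u p == v)) p0.
- by case/andP=> /and3P[_ /andP[]].
- by rewrite g0 l0 eqxx.
have [|[h hV hP]] := gpath_cover gp; first by rewrite lp.
exfalso; have [pth up /allP pV0] := and3P gp; have pV : {subset u :: p <= V} := pV0.
have lng' q (gq : gpath V u q) (lq : last u q = last u p) : size q <= size p.
  by apply: lng; rewrite gq lq lp eqxx.
have vP : v \in u :: p by rewrite -lp mem_last.
have pair x y : x \in u :: p -> y \in u :: p -> attached (u :: p) V h x ->
    attached (u :: p) V h y -> x != y -> (x == v) || (y == v).
  move=> xP yP ax ay; apply: contra_neqT; rewrite negb_or -lp => /andP[xl yl].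
  exact: attached_pair K gp hV hP lng' ax ay xP yP xl yl.
have pair' x y : x \in u :: p -> y \in u :: p -> attached (u :: p) V h x ->
    attached (u :: p) V h y -> x != y -> (x == u) || (y == u).
  have [q gq [lq pq]] := gpath_rev gp; rewrite -!(perm_mem pq) -!(attached_perm _ _ pq).
  move=> xP yP ax ay; apply: contra_neqT; rewrite negb_or -lq => /andP[xl yl].
  apply: attached_pair K gq hV _ _ ax ay xP yP xl yl; first by rewrite (perm_mem pq).
  move=> r gr lr; have [r' gr' [lr' pr']] := gpath_rev gr.
  have : size r' <= size p by move: gr' lr'; rewrite lr lq => gr' lr'; apply: lng'.
  by move/perm_size: pr'; move/perm_size: pq => /= [->] [->].
have [x [xP _ ax]] := attached_in hV hP (subxx V) ndV hV uV (mem_head u p).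
have [z zP nzx] : exists2 z, z \in u :: p & z != x.
  by have [xu|] := eqVneq u x; [exists v; rewrite // -xu eq_sym|exists u; rewrite ?mem_head].
have [||y [yP]] := attached_in hV hP (subsetDl V [set x]) (ndVx _ (pV _ xP)) _ _ zP.
- by rewrite !inE hV andbT; apply: contraNneq hP => ->.
- by rewrite !inE nzx pV.
rewrite !inE eq_sym => /andP[nxy _] ay.
have [au av] : attached (u :: p) V h u /\ attached (u :: p) V h v.
  move: (pair _ _ xP yP ax ay nxy) (pair' _ _ xP yP ax ay nxy).
  case/orP=> /eqP ev /orP[] /eqP eu.
  - by case/eqP: nuv; rewrite -eu -ev.
  - by rewrite ev in ax; rewrite eu in ay.
  - by rewrite eu in ax; rewrite ev in ay.
  by case/eqP: nuv; rewrite -eu -ev.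
have uvonly z' : z' \in u :: p -> attached (u :: p) V h z' -> z' \in [set u; v].
  move=> tP at_; rewrite !inE; have [//|ntu] := eqVneq z' u.
  by move: (pair _ _ tP (mem_head u p) at_ au ntu); rewrite (negPf nuv) orbF.
have nul : u != last u p by rewrite lp.
have [s1 [b [s2 eqP]]] := next_split (mem_head u p) nul.
have nbv : b != v.
  by apply: contraTneq av => <-; apply: (attached_consec gp hV hP lng' eqP au).
have eqs : s1 = [::].
  case: s1 eqP => // a s1 [ea ep]; move: up.
  by rewrite /= ep mem_cat mem_head orbT.
rewrite {s1}eqs /= in eqP; have bP : b \in u :: p by rewrite eqP !inE eqxx orbT.
have nbu : b != u by move: up; rewrite eqP /= inE negb_or eq_sym => /andP[/andP[]].
have [||y' [y'P y'W ay']] := attached_in hV hP (subsetDl V [set u; v]) ndVuv _ _ bP.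
- rewrite !inE hV andbT negb_or; apply/andP; split; apply: contraNneq hP => -> //.
  exact: mem_head.
- by rewrite !inE negb_or nbu nbv pV.
by move: y'W; rewrite inE uvonly.
Qed.
(** In this form the non-neighbours of x are seen to contain no independent triple. *)
Lemma four_K1_freeP : four_K1_free e -> forall x y z w, uniq [:: x; y; z; w] ->
  ~~ e x y -> ~~ e x z -> ~~ e x w -> [|| e y z, e y w | e z w].
Proof.
move=> free x y z w us nxy nxz nxw; apply: contraT; rewrite !negb_or => /and3P[nyz nyw nzw].
pose S := [set a in [:: x; y; z; w]].
have /free/negP[] : #|S| = 4 by rewrite cardsE (card_uniqP us).
apply/forall_inP => a; rewrite inE => aS; apply/forall_inP => b; rewrite inE => bS.
apply/implyP; move: aS bS; rewrite !inE => /or4P[]/eqP-> /or4P[]/eqP->.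
all: by rewrite ?eqxx // e_sym.
Qed.

(** * Several attachments in a $4K_1$-free graph *)

Section Detours.

Hypothesis free : four_K1_free e.

Variables (V : {set T}) (u : T) (p : seq T) (h : T).
Hypothesis gp : gpath V u p.
Hypothesis longest : forall q, gpath V u q -> size q <= size p.
Hypotheses (hV : h \in V) (hP : h \notin u :: p).

Let P := u :: p.
Let att := attached P V h.
Let lng q (gq : gpath V u q) (_ : last u q = last u p) := longest gq.

(** Together with h the three successors would be four pairwise non-adjacent vertices. *)
Lemma attached_le2 x y z : att x -> att y -> att z -> x \in P -> y \in P -> z \in P ->
  uniq [:: x; y; z] -> False.
Proof.
move=> ax ay az xP yP zP; rewrite /= !inE negb_or andbT => /andP[/andP[nxy nxz] nyz].
have nl w (aw : att w) := attached_not_last gp longest hV hP aw.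
have [s1 [b [s2 eqx]]] := next_split xP (nl _ ax).
have [t1 [c [t2 eqy]]] := next_split yP (nl _ ay).
have [r1 [d [r2 eqz]]] := next_split zP (nl _ az).
have [nbc ebc nab nac] := next_indep gp hV hP lng eqx eqy ax ay nxy.
have [nbd ebd _ nad] := next_indep gp hV hP lng eqx eqz ax az nxz.
have [ncd ecd _ _] := next_indep gp hV hP lng eqy eqz ay az nyz.
have nh r1' w r2' b' : P = r1' ++ w :: b' :: r2' -> h != b'.
  by move=> eqP; apply: contraNneq hP => ->; rewrite -/P eqP mem_cat !inE eqxx !orbT.
have := @four_K1_freeP free h b c d.
rewrite (negPf ebc) (negPf ebd) (negPf ecd) /= !inE !negb_or nbc nbd ncd.
rewrite (nh _ _ _ _ eqx) (nh _ _ _ _ eqy) (nh _ _ _ _ eqz).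
by rewrite !(not_attached hV hP) // => /(_ isT isT isT isT).
Qed.

(** As x and y are the only attachments, h has no neighbour elsewhere on P, so P without x and y has
    no independent triple and [detour_absorb] applies. *)
Lemma attached_ordered r1 x b r2 y c r3 : P = r1 ++ x :: b :: r2 ++ y :: c :: r3 ->
  att x -> att y -> x != u -> False.
Proof.
move=> defP ax ay nxu; have [pth uP /allP PV] := and3P gp.
have [xP yP] : x \in P /\ y \in P by rewrite defP !(mem_cat, inE) !eqxx !orbT.
have nxy : x != y.
  have pP : perm_eq P (x :: y :: r1 ++ b :: r2 ++ c :: r3) by rewrite defP; perm_solve.
  by move: uP; rewrite -/P (perm_uniq pP) /= inE negb_or => /andP[/andP[]].
have only z : att z -> z \in P -> (z == x) || (z == y).
  move=> az zP; apply: contraT; rewrite negb_or => /andP[zx zy].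
  case: (@attached_le2 x y z) => //; rewrite /= !inE negb_or andbT nxy.
  by rewrite eq_sym zx eq_sym zy.
have [D [d1 [d2 [hD uD DV xd1 d2y]]]] := detour hV hP ax ay.
(* Since x is not u, it has a predecessor a. *)
case/lastP: r1 defP => [|r1 a] defP; first by case: defP nxu => ->; rewrite eqxx.
have [hA pA _] := path_split pth (s := r1) (etrans defP (cat_rcons _ _ _)).
move: pA; rewrite /= cat_path => /and3P[eax exb /= /and4P[pB eby eyc pC]].
set A := rcons r1 a; set B := b :: r2; set C := c :: r3.
have pW : perm_eq (A ++ x :: B ++ y :: C ++ D) (P ++ D) by rewrite defP; perm_solve.
have uW : uniq (A ++ x :: B ++ y :: C ++ D) by rewrite (perm_uniq pW) uD.
have far z : z \in A ++ B ++ C -> (h != z) && ~~ e h z.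
  move=> zABC; have pP : perm_eq P (x :: y :: A ++ B ++ C) by rewrite defP; perm_solve.
  have zP : z \in P by rewrite (perm_mem pP) !inE zABC !orbT.
  apply/andP; split; first by apply: contraNneq hP => ->.
  apply: (not_attached hV hP); apply: contraL zABC => /only/(_ zP).
  move: uP; rewrite -/P (perm_uniq pP) /= inE negb_or => /and3P[/andP[_ xn] yn _].
  by case/orP=> /eqP->.
apply: (detour_absorb uW hA eax exb (erefl _) pB (erefl _) eby eyc (erefl _) pC (erefl _) hD xd1 d2y).
  move=> z1 z2 z3 /far/andP[n1 e1] /far/andP[n2 e2] /far/andP[n3 e3] un.
  by apply: (four_K1_freeP free (x := h)) => //; rewrite cons_uniq un !inE !negb_or n1 n2 n3.
by move=> w'; apply: (no_longer_start gp longest hD uD DV pW).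
Qed.

Lemma attached_start x y : att x -> att y -> x \in P -> y \in P -> x != y -> x != u ->
  y != u -> False.
Proof.
move=> ax ay xP yP nxy nxu nyu.
have nl w (aw : att w) := attached_not_last gp longest hV hP aw.
have [s1 [b [s2 eqx]]] := next_split xP (nl _ ax).
have [t1 [c [t2 eqy]]] := next_split yP (nl _ ay).
have [_ _ nab nac] := next_indep gp hV hP lng eqx eqy ax ay nxy.
have nyb : y != b by apply: contraNneq nab => <-.
have nxc : x != c by apply: contraNneq nac => <-.
have [_ uP _] := and3P gp.
have [[r1 [r2 [r3 eqP]]]|[r1 [r2 [r3 eqP]]]] := order_split uP eqx eqy nxy nyb nxc.
  exact: attached_ordered eqP ax ay nxu.
exact: attached_ordered eqP ay ax nyu.
Qed.

End Detours.

(** * Graphs without articulation points *)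

Section NoArticulation.

Hypothesis free : four_K1_free e.
Hypothesis ndT : nd [set: T].
Hypothesis ndTx : forall x, nd ([set: T] :\ x).

Lemma ham_or_cut u : (exists w, ham (enum [set: T]) u w) \/
  exists2 x, x != u & disconnected e ([set: T] :\: [set u; x]).
Proof.
have g0 : gpath [set: T] u [::] by rewrite /gpath /= inE.
have [p|p gp lng] := ex_longest _ g0; first by case/and3P=> _ /andP[].
have [|[h hV hP]] := gpath_cover gp; first by left; exists (last u p).
right; have [pth up _] := and3P gp.
have uP := mem_head u p.
have [x [xP _ ax]] := attached_in hV hP (subxx _) ndT hV (in_setT u) uP.
have nl w (aw : attached (u :: p) [set: T] h w) := attached_not_last gp lng hV hP aw.
have second x' : x' \in u :: p -> attached (u :: p) [set: T] h x' ->
    exists y, [/\ y \in u :: p, y != x' & attached (u :: p) [set: T] h y].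
  move=> x'P ax'; have [] := attached_in hV hP (subsetDl _ [set x']) (ndTx x') _ _ (mem_last u p).
  - by rewrite !inE andbT; apply: contraNneq hP => ->.
  - by rewrite !inE andbT eq_sym nl.
  by move=> y [yP]; rewrite !inE andbT => nyx ay; exists y.
have [y [yP nyx ay]] := second _ xP ax.
have [au|nau] := boolP (attached (u :: p) [set: T] h u); last first.
  case: (attached_start free gp lng hV hP ax ay xP yP).
  - by rewrite eq_sym.
  - by apply: contraNneq nau => xu; rewrite xu in ax.
  by apply: contraNneq nau => yu; rewrite yu in ay.
have [z [zP nzu az]] := second _ uP au.
(* By [attached_le2] only u and z are attachments; were G - {u, z} connected, [attached_in] would
   yield a third one between h and the successor of z. *)
exists z => //; apply: contraT => ndc.
have only w : w \in u :: p -> attached (u :: p) [set: T] h w -> w \in [set u; z].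
  move=> wP aw; rewrite !inE; apply: contraT; rewrite negb_or => /andP[nwu nwz].
  case: (attached_le2 free gp lng hV hP aw au az wP uP zP).
  by rewrite /= !inE negb_or nwu nwz andbT /= eq_sym nzu.
have [s1 [b [s2 eqP]]] := next_split zP (nl _ az).
have lng' q (gq : gpath [set: T] u q) (_ : last u q = last u p) := lng q gq.
have nab := attached_consec gp hV hP lng' eqP az.
have bP : b \in u :: p by rewrite eqP mem_cat !inE eqxx !orbT.
have [] := attached_in hV hP (subsetDl _ [set u; z]) ndc _ _ bP.
- by rewrite !inE andbT negb_or; apply/andP; split; apply: contraNneq hP => ->.
- by rewrite !inE andbT negb_or; apply/andP; split; apply: contraNneq nab => ->.
by move=> y' [y'P y'W ay']; move: y'W; rewrite inE only.
Qed.

Lemma ham_exists u0 : exists u w, ham (enum [set: T]) u w.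
Proof.
(* The start varies, so whole vertex sequences are compared; the empty one is excluded. *)
have [[|u p] //||[|u p] //= gp lng] :=
  @ex_longest (fun s => if s is u :: p then gpath [set: T] u p else false) [:: u0].
- by case/and3P.
- by rewrite /gpath /= inE.
have lngu q (gq : gpath [set: T] u q) : size q <= size p := lng (u :: q) gq.
have [|[h hV hP]] := gpath_cover gp; first by exists u, (last u p).
have [pth up _] := and3P gp; have uP := mem_head u p.
have [x [xP _ ax]] := attached_in hV hP (subxx _) ndT hV (in_setT u) uP.
have nl := attached_not_last gp lngu hV hP ax.
have [||y [yP]] := attached_in hV hP (subsetDl _ [set x]) (ndTx x) _ _ (mem_last u p).
- by rewrite !inE andbT; apply: contraNneq hP => ->.
- by rewrite !inE andbT eq_sym.
rewrite !inE andbT => nyx ay.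
have nau : ~~ attached (u :: p) [set: T] h u.
  apply/negP => au; have [D [d1 [d2 [hD uD DV _ d2u]]]] := detour hV hP au au.
  have hQ := ham_cat hD d2u (ham_path pth).
  have pQ : perm_eq (D ++ u :: p) ((u :: p) ++ D) by rewrite perm_catC.
  have [||q [gq _ sq]] := ham_gpath (V := [set: T]) hQ.
  - by rewrite (perm_uniq pQ) uD.
  - by move=> z; rewrite inE.
  have := lng (d1 :: q) gq; rewrite /= sq size_cat.
  by case: hD => r [_ /perm_size <- _] /=; clear; lia.
case: (attached_start free gp lngu hV hP ax ay xP yP).
- by rewrite eq_sym.
- by apply: contraNneq nau => xu; rewrite xu in ax.
by apply: contraNneq nau => yu; rewrite yu in ay.
Qed.

End NoArticulation.

(** * Articulation points *)

Lemma other_component A Q : #|components e A| = 2 -> Q \in components e A ->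
  exists Q', [/\ Q' \in components e A, Q != Q', A = Q :|: Q' & [disjoint Q & Q']].
Proof.
move=> c2 Qc; have /and3P[/eqP cov tr _] := components_part A.
have [Q' defc] : exists Q', components e A :\ Q = [set Q'].
  by apply/cards1P; have := cardsD1 Q (components e A); rewrite c2 Qc => -[cD]; rewrite -[#|_|]cD.
have : Q' \in components e A :\ Q by rewrite defc set11.
rewrite !inE eq_sym => /andP[nQ Q'c]; exists Q'; split=> //.
  by rewrite -cov /cover (big_setD1 Q) //= defc big_set1.
exact: (trivIsetP tr).
Qed.

Lemma ham_enumU A S u v w z : [disjoint A & S] -> ham (enum A) u v -> e v w ->
  ham (enum S) w z -> ham (enum (A :|: S)) u z.
Proof.
move=> dAS hA evw hS; apply: ham_perm (ham_cat hA evw hS) _.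
apply: uniq_perm; rewrite ?enum_uniq // ?cat_uniq ?enum_uniq ?andbT /=.
  by apply/hasPn => x; rewrite /= !mem_enum => xS; rewrite (disjointFl dAS).
by move=> x; rewrite mem_cat !mem_enum inE.
Qed.

Lemma ham_enum1 u : ham (enum [set u]) u u.
Proof. by rewrite enum_set1; apply: ham1. Qed.

Lemma component_triple_free A C z : four_K1_free e -> C \in components e A -> z \in A -> z \notin C ->
  triple_free (mem C).
Proof.
move=> free CA zA zC x y w xC yC wC us.
have nz a : a \in C -> ~~ e z a && (z != a).
  move=> aC; apply/andP; split; last by apply: contraNneq zC => ->.
  by apply: contra zC => eza; apply: (component_closed CA aC zA); rewrite e_sym.
move: (nz _ xC) (nz _ yC) (nz _ wC) => /andP[e1 n1] /andP[e2 n2] /andP[e3 n3].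
by apply: (four_K1_freeP free) e1 e2 e3; rewrite cons_uniq us !inE !negb_or n1 n2 n3.
Qed.

Lemma articulationE H x : articulation e H x = (x \in H) && disconnected e (H :\ x).
Proof. by rewrite /articulation /vertex_cut sub1set. Qed.

Lemma separation A : disconnected e A -> exists S R,
  [/\ A = S :|: R, [disjoint S & R], S != set0, R != set0 &
      forall x y, x \in S -> y \in R -> ~~ e x y].
Proof.
case/disconnectedP=> S [x [y [cS SA xS yA yS]]]; exists S, (A :\: S); split.
- by apply/setP => z; rewrite !inE; case: (boolP (z \in S)) => //= /(subsetP SA) ->.
- by rewrite -setI_eq0; apply/eqP/setP => z; rewrite !inE; case: (z \in S).
- by apply/set0Pn; exists x.
- by apply/set0Pn; exists y; rewrite inE yS.
move=> a b aS; rewrite inE => /andP[bS bA]; apply: contra bS; exact: cS.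
Qed.

Lemma triple_free_sep_clique A S R : triple_free (mem A) -> S \subset A -> R \subset A ->
  [disjoint S & R] -> R != set0 -> (forall x y, x \in S -> y \in R -> ~~ e x y) ->
  {in S &, forall x y, x != y -> e x y}.
Proof.
move=> K SA RA dSR /set0Pn[r rR] sep x y xS yS nxy.
have neq z : z \in S -> r != z by move=> zS; apply: contraTneq zS => <-; rewrite (disjointFl dSR).
have sep' z : z \in S -> ~~ e r z by move=> zS; rewrite e_sym; apply: sep.
apply: (triple_freeP K (subsetP RA _ rR) (subsetP SA _ xS) (subsetP SA _ yS)).
all: by rewrite ?neq ?sep'.
Qed.

(** The complement of a closed set is closed, and one of the two contains v. *)
Lemma nd_from A v : v \in A -> (forall S, closed_in A S -> v \in S -> {subset A <= S}) -> nd A.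
Proof.
move=> vA from; apply/disconnectedP => -[S [x [y [cS SA xS yA yS]]]].
have [vS|vS] := boolP (v \in S); first by rewrite (from S) in yS.
have := from _ (closed_inD cS) _ x (subsetP SA _ xS).
by rewrite !inE vS vA xS => /(_ isT).
Qed.

Lemma disconnected_avoid A v : disconnected e A -> v \in A ->
  exists S x, [/\ closed_in A S, S \subset A, x \in S & v \notin S].
Proof.
case/disconnectedP=> S [x [y [cS SA xS yA yS]]] vA.
have [vS|vS] := boolP (v \in S); last by exists S, x.
exists (A :\: S), y; split; rewrite ?subsetDl ?inE ?yS ?vS //.
exact: closed_inD.
Qed.

Lemma disconnected_closed A S x y : closed_in A S -> x \in S -> x \in A -> y \in A ->
  y \notin S -> disconnected e A.
Proof. by move=> cS xS xA yA; apply: contraR => ndA; apply: (ndE ndA cS xS xA yA). Qed.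

(* Otherwise every neighbour of x in Q cuts Q into two cliques; there are at most
   two of them, and they are articulation points of G forming a triangle with x. *)
Lemma articulation_exit x Q : four_K1_free e -> articulation e [set: T] x ->
    (forall x, articulation e [set: T] x -> #|components e (~: [set x])| = 2) ->
    (forall x y z, articulation e [set: T] x -> articulation e [set: T] y ->
       articulation e [set: T] z -> ~ [/\ e x y, e y z & e x z]) ->
    nd [set: T] -> Q \in components e (~: [set x]) ->
  exists v, [/\ v \in Q, e x v & nd (Q :\ v)].
Proof.
move=> free artx two notri ndT Qc.
have ndQ := component_nd Qc.
have xQ : x \notin Q by apply/negP => /(subsetP (component_sub Qc)); rewrite !inE eqxx.
have [q qQ] := component_ex Qc.
have nbQ a b : a \in Q -> e a b -> (b == x) || (b \in Q).
  move=> aQ eab; have [//|nbx] := eqVneq b x.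
  by apply: (component_closed Qc aQ _ eab); rewrite !inE.
have [z0 z0x z0Q] : exists2 z, z \in ~: [set x] & z \notin Q.
  have [Q' [Q'c _ _ dQ]] := other_component (two x artx) Qc; have [z zQ'] := component_ex Q'c.
  by exists z; [apply: (subsetP (component_sub Q'c))|rewrite (disjointFl dQ)].
have K := component_triple_free free Qc z0x z0Q.
have [v vQ exv] : exists2 v, v \in Q & e x v.
  have [/exists_inP//|no] := boolP [exists v in Q, e x v].
  case/negP: xQ; apply: (ndE ndT _ qQ) => // a b aQ _ eab.
  case/orP: (nbQ a b aQ eab) => // /eqP bx; case/exists_inP: no.
  by exists a; rewrite // e_sym -bx.
have [/existsP[y /and3P[yQ exy ndy]]|no] := boolP [exists y, [&& y \in Q, e x y & nd (Q :\ y)]].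
  by exists y.
have {}no y : y \in Q -> e x y -> disconnected e (Q :\ y).
  by move=> yQ exy; apply: contraR no => ndy; apply/existsP; exists y; rewrite yQ exy.
exfalso; have [S [R [defQ dSR S0 R0 sep]]] := separation (no v vQ exv).
have vSR : v \notin S :|: R by rewrite -defQ !inE eqxx.
have closedG S' R' : Q :\ v = S' :|: R' -> (forall a b, a \in S' -> b \in R' -> ~~ e a b) ->
    (forall a, a \in S' -> ~~ e x a) -> closed_in ([set: T] :\ v) S'.
  move=> defQ' sep' nx a b aS; rewrite !inE andbT => nbv eab.
  have : a \in Q :\ v by rewrite defQ' inE aS.
  rewrite inE => /andP[_ aQ]; have /orP[/eqP bx|bQ] := nbQ a b aQ eab.
    by move: (nx a aS); rewrite e_sym -bx eab.
  have : b \in Q :\ v by rewrite !inE nbv.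
  by rewrite defQ' inE => /orP[//|/(sep' a b aS)]; rewrite eab.
have subQ a : a \in S :|: R -> (a \in Q) && (a != v).
  by rewrite -defQ !inE andbC.
(* If v is the only neighbour of x in Q, then S, R and x lie in three different components of G -
   v. *)
have [/existsP[w /and3P[wQ exw nwv]]|only] := boolP [exists w, [&& w \in Q, e x w & w != v]]; last first.
  have nx a : a \in S :|: R -> ~~ e x a.
    move=> /subQ/andP[aQ nav]; apply: contra only => exa.
    by apply/existsP; exists a; rewrite aQ exa.
  have [/set0Pn[s sS] /set0Pn[r rR]] := (S0, R0).
  have cS : closed_in ([set: T] :\ v) S.
    by apply: closedG defQ sep _ => a aS; apply: nx; rewrite inE aS.
  have cR : closed_in ([set: T] :\ v) R.
    apply: (closedG R S); [by rewrite setUC|by move=> a b aR bS; rewrite e_sym sep|].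
    by move=> a aR; apply: nx; rewrite inE aR orbT.
  have sT : s \in [set: T] :\ v by rewrite !inE andbT; case/andP: (subQ s (subsetP (subsetUl S R) _ sS)).
  have rT : r \in [set: T] :\ v by rewrite !inE andbT; case/andP: (subQ r (subsetP (subsetUr S R) _ rR)).
  have xT : x \in [set: T] :\ v by rewrite !inE andbT; apply: contraNneq xQ => ->.
  have xSR : x \notin S :|: R by apply/negP => /subQ/andP[xQ' _]; rewrite xQ' in xQ.
  move: xSR; rewrite inE negb_or => /andP[xS xR].
  have artv : articulation e [set: T] v.
    by rewrite articulationE inE; apply: (disconnected_closed cS sS sT xT xS).
  have := components_ge3 cS cR sS rR xT sT rT (negbT (disjointFl dSR rR)) xS xR.
  by rewrite setTD (two v artv).
(* By symmetry the second neighbour w of x may be taken in S. *)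
have main S' R' : Q :\ v = S' :|: R' -> [disjoint S' & R'] -> S' != set0 -> R' != set0 ->
    (forall x y, x \in S' -> y \in R' -> ~~ e x y) -> w \in S' -> False; last first.
  have : w \in Q :\ v by rewrite !inE nwv.
  rewrite defQ inE => /orP[wS|wR]; first exact: main defQ dSR S0 R0 sep wS.
  apply: (main R S) => //; first by rewrite setUC.
    by rewrite disjoint_sym.
  by move=> a b aR bS; rewrite e_sym sep.
move=> {S R defQ dSR S0 R0 sep vSR subQ} defQ dSR S0 R0 sep wS.
set S := S' in defQ dSR S0 sep wS; set R := R' in defQ dSR R0 sep.
have QE a : (a \in Q) = [|| a == v, a \in S | a \in R].
  have [->|nav] /= := eqVneq a v; first by rewrite vQ.
  by have := in_setU a S R; rewrite -defQ !inE nav.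
have [SQ RQ] : S \subset Q /\ R \subset Q.
  by split; apply/subsetP => a; rewrite QE => ->; rewrite ?orbT.
have [vS vR] : v \notin S /\ v \notin R.
  have : v \notin Q :\ v by rewrite !inE eqxx.
  by rewrite defQ inE negb_or => /andP[].
have clS := triple_free_sep_clique K SQ RQ dSR R0 sep.
have clR : {in R &, forall a b, a != b -> e a b}.
  apply: (triple_free_sep_clique K RQ SQ) => //; first by rewrite disjoint_sym.
  by move=> a b aR bS; rewrite e_sym sep.
have nbv S1 R1 : Q :\ v = S1 :|: R1 -> S1 != set0 -> (forall a b, a \in S1 -> b \in R1 -> ~~ e a b) ->
    exists2 s, s \in S1 & e v s.
  move=> def1 /set0Pn[s sS1] sep1.
  have [/exists_inP//|nov] := boolP [exists s in S1, e v s].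
  have : v \in S1.
    have sQ : s \in Q by have := in_setU s S1 R1; rewrite -def1 sS1 !inE => /andP[].
    apply: (ndE ndQ _ sS1) => // a b aS1 bQ eab; have [bv|nbv] := eqVneq b v.
      by case/exists_inP: nov; exists a; rewrite // e_sym -bv.
    have : b \in Q :\ v by rewrite !inE nbv.
    by rewrite def1 inE => /orP[//|/(sep1 a b aS1)]; rewrite eab.
  by move=> vS1; have := in_setU v S1 R1; rewrite -def1 vS1 !inE eqxx.
have [r0 r0R evr0] : exists2 r, r \in R & e v r.
  by apply: (nbv R S) => //; [rewrite setUC|move=> a b aR bS; rewrite e_sym sep].
have [s1 s1S evs1] := nbv S R defQ S0 sep.
(* S1 is a part of Q - w away from v. It contains no neighbour of v, hence nothing of the clique R,
   which puts s in S. *)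
have [|S1 [s [cS1 S1Q sS1 vS1]]] := disconnected_avoid (no w wQ exw) (_ : v \in Q :\ w).
  by rewrite !inE vQ eq_sym nwv.
have wR : w \notin R by rewrite (disjointFr dSR).
have avoid a : a \in Q -> a != w -> e v a -> a \notin S1.
  move=> aQ naw eva; apply: contra vS1 => aS1; apply: (cS1 a) => //; last by rewrite e_sym.
  by rewrite !inE vQ eq_sym nwv.
have RS1 r : r \in R -> r \notin S1.
  move=> rR; have r0S1 : r0 \notin S1.
    by apply: avoid => //; [apply: (subsetP RQ)|apply: contraNneq wR => <-].
  have [->//|nr] := eqVneq r r0; apply: contra r0S1 => rS1; apply: (cS1 r) => //.
    by rewrite !inE (subsetP RQ) // andbT; apply: contraNneq wR => <-.
  exact: clR.
have [sQ nsw] : s \in Q /\ s != w by have := subsetP S1Q _ sS1; rewrite !inE => /andP[].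
have nsv : s != v by apply: contraNneq vS1 => <-.
have sS : s \in S.
  by move: sQ; rewrite QE (negPf nsv) /= => /orP[//|/RS1]; rewrite sS1.
have nvs : ~~ e v s by apply/negP => /(avoid _ sQ nsw); rewrite sS1.
(* Any other a would be joined to s inside the clique S and so fall into S1. *)
have vw a : a \in S -> e v a -> a = w.
  move=> aS eva; apply/eqP; apply: contraT => naw.
  have aQ := subsetP SQ _ aS; have aS1 := avoid a aQ naw eva.
  have nas : a != s by apply: contraNneq nvs => <-.
  case/negP: aS1; apply: (cS1 s) => //; first by rewrite !inE naw.
  by apply: clS => //; rewrite eq_sym.
have evw : e v w by rewrite -(vw s1).
have evR r : r \in R -> e v r.
  move=> rR; apply: (triple_freeP K sQ vQ (subsetP RQ _ rR)) => //.
  - by apply: contraTneq sS => ->; rewrite (disjointFl dSR).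
  - by rewrite e_sym.
  - exact: sep.
  by apply: contraNneq vR => ->.
(* Deleting a third neighbour z would leave Q connected: v reaches w and R directly, and w reaches
   S. *)
have onlyvw z : z \in Q -> e x z -> (z == v) || (z == w).
  move=> zQ exz; apply: contraT; rewrite negb_or => /andP[nzv nzw].
  suff : nd (Q :\ z) by rewrite /nd (no z).
  apply: (nd_from (v := v)); first by rewrite !inE vQ eq_sym nzv.
  move=> S2 cS2 vS2 a; rewrite !inE => /andP[naz aQ].
  have wS2 : w \in S2 by apply: (cS2 v); rewrite // !inE wQ eq_sym nzw.
  have := aQ; rewrite QE => /or3P[/eqP->//|aS|aR].
    have [->//|naw] := eqVneq a w; apply: (cS2 w); rewrite // ?inE ?naz ?aQ //.
    by apply: clS; rewrite // eq_sym.
  by apply: (cS2 v); rewrite // ?inE ?naz ?aQ // evR.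
have artv : articulation e [set: T] v.
  rewrite articulationE inE; apply: (disconnected_closed (S := R) (x := r0) (y := w)) => //.
  - apply: (closedG R S); first by rewrite setUC.
      by move=> a b aR bS; rewrite e_sym sep.
    move=> a aR; apply/negP => /(onlyvw _ (subsetP RQ _ aR))/orP[]/eqP ea.
      by rewrite -ea aR in vR.
    by rewrite -ea aR in wR.
  - by rewrite !inE andbT; apply: contraNneq vR => <-.
  by rewrite !inE andbT.
have artw : articulation e [set: T] w.
  rewrite articulationE inE; apply: (disconnected_closed (S := S :\ w) (x := s) (y := v)) => //.
  - move=> a b; rewrite !inE !andbT => /andP[naw aS] nbw eab; rewrite nbw /=.
    have aQ := subsetP SQ _ aS; have /orP[/eqP bx|] := nbQ a b aQ eab.
      have := onlyvw a aQ; rewrite e_sym -bx eab (negPf naw) orbF => /(_ isT)/eqP av.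
      by rewrite -av aS in vS.
    rewrite QE => /or3P[/eqP bv|//|bR]; last by move: (sep a b aS bR); rewrite eab.
    by case/eqP: naw; apply: vw; rewrite // e_sym -bv.
  - by rewrite !inE nsw.
  - by rewrite !inE nsw.
  - by rewrite !inE andbT eq_sym.
  by rewrite !inE (negPf vS) andbF.
by apply: (notri x v w).
Qed.
(** * Connectivity *)

Lemma vertex_cut_nonclique H A : vertex_cut e H A -> ~~ clique e H.
Proof.
case/andP=> AH /separation[S [R [def dSR /set0Pn[x xS] /set0Pn[y yR] sep]]].
have [xH yH] : x \in H /\ y \in H.
  have := in_setU x S R; have := in_setU y S R.
  by rewrite -def xS yR orbT !inE => /andP[_ ->] /andP[_ ->].
apply/negP => /forall_inP/(_ x xH)/forall_inP/(_ y yH)/implyP cl.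
have nxy : x != y by apply: contraTneq xS => ->; rewrite (disjointFl dSR).
by have := sep x y xS yR; rewrite cl.
Qed.

Lemma connectivity_le H A : vertex_cut e H A -> connectivity e H <= #|A|.
Proof.
move=> cA; rewrite /connectivity (negPf (vertex_cut_nonclique cA)).
elim: (index_enum _) (mem_index_enum A) => //= B r IH; rewrite inE big_cons.
case/predU1P=> [<-|/IH leA]; first by rewrite cA geq_minl.
by case: ifP => _ //; rewrite geq_min leA orbT.
Qed.

Lemma k_connected2_nd H : k_connected e 2 H -> nd H /\ forall x, x \in H -> nd (H :\ x).
Proof.
move=> k2; split=> [|x xH]; apply/negP => d.
  have : vertex_cut e H set0 by rewrite /vertex_cut sub0set setD0.
  by move/connectivity_le/(leq_trans k2); rewrite cards0.
have : vertex_cut e H [set x] by rewrite /vertex_cut sub1set xH.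
by move/connectivity_le/(leq_trans k2); rewrite cards1.
Qed.

Lemma nd_k_connected2 H : ~~ clique e H -> nd H -> (forall x, x \in H -> nd (H :\ x)) ->
  k_connected e 2 H.
Proof.
move=> ncl ndH ndx; rewrite /k_connected /connectivity (negPf ncl).
elim/big_ind: _ => [|a b ha hb|A /andP[AH dA]]; last 1 first.
- rewrite ltnNge; apply/negP; rewrite leq_eqVlt ltnS leqn0 cards_eq0 => /orP[/cards1P[x defA]|/eqP A0].
    by move: AH dA; rewrite defA sub1set => xH; apply/negP/ndx.
  by move: dA; rewrite A0 setD0; apply/negP.
(* The default value of the minimum is the order of H, which is at least 2 because H has two
   non-adjacent vertices. *)
- move: ncl; rewrite /clique negb_forall_in => /exists_inP[x xH].
  rewrite negb_forall_in => /exists_inP[y yH]; rewrite negb_imply => /andP[nxy _].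
  apply: leq_trans (_ : #|[set x; y]| <= _); first by rewrite cards2 nxy.
  by apply: subset_leq_card; apply/subsetP => z; rewrite !inE => /orP[]/eqP->.
by rewrite leq_min ha hb.
Qed.

Lemma clique_set_ham S a b : {in S &, forall x y, x != y -> e x y} -> a \in S -> b \in S ->
  a != b \/ S = [set a] -> ham (enum S) a b.
Proof.
move=> cl aS bS [nab|SE].
  apply: ham_clique; rewrite ?enum_uniq ?mem_enum // => x y.
  by rewrite !mem_enum; apply: cl.
by move: bS; rewrite SE inE => /eqP->; apply: ham_enum1.
Qed.

Lemma in_different_componentsP A u v : in_different_components e A u v ->
  [/\ u \in A, v \in A & v \notin component_of e A u].
Proof.
case=> C [D [CA DA nCD uC vD]]; split.
- exact: (subsetP (component_sub CA)).
- exact: (subsetP (component_sub DA)).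
apply: contra nCD; rewrite -(component_unique CA uC) => vC.
by rewrite (component_unique CA vC) (component_unique DA vD).
Qed.

(** Q - y splits into cliques S, containing u, and R, containing the v given by (c). The path runs
    through S, then y, then R. *)
Lemma exit_two_cliques (Q : {set T}) u x y : triple_free (mem Q) -> nd Q -> u \in Q -> nd (Q :\ u) ->
    (forall y, articulation e Q y -> y != u -> exists v,
       [/\ v \in Q, e x v & in_different_components e (Q :\ y) u v]) ->
    articulation e Q y -> y != u ->
  exists v, [/\ v \in Q, e x v & ham (enum Q) u v].
Proof.
move=> K ndQ uQ ndQu condc arty nyu.
have [v [vQ exv /in_different_componentsP[uQy vQy vC]]] := condc y arty nyu.
move: arty; rewrite articulationE => /andP[yQ dQy].
have [S [R [[defQ dSR S0 R0 sep] uS]]] : exists S R, [/\ Q :\ y = S :|: R, [disjoint S & R],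
    S != set0 , R != set0 & forall x y, x \in S -> y \in R -> ~~ e x y] /\ u \in S.
  have [S [R [defQ dSR S0 R0 sep]]] := separation dQy.
  move: (uQy); rewrite defQ inE => /orP[uS|uR]; first by exists S, R.
  exists R, S; split=> //; split=> //; rewrite 1?setUC 1?disjoint_sym //.
  by move=> a b aR bS; rewrite e_sym sep.
have clR S' R' : Q :\ y = S' :|: R' -> [disjoint S' & R'] -> R' != set0 ->
    (forall x y, x \in S' -> y \in R' -> ~~ e x y) -> {in S' &, forall a b, a != b -> e a b}.
  move=> def' d' R'0 sep'; apply: (triple_free_sep_clique K _ _ d' R'0 sep').
    by apply: subset_trans (subsetDl Q [set y]); rewrite def' subsetUl.
  by apply: subset_trans (subsetDl Q [set y]); rewrite def' subsetUr.
have clS := clR S R defQ dSR R0 sep.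
have sepC a b : a \in R -> b \in S -> ~~ e a b by move=> aR bS; rewrite e_sym sep.
have {clR} clR : {in R &, forall a b, a != b -> e a b}.
  by apply: (clR R S) => //; rewrite 1?setUC 1?disjoint_sym.
have QE a : (a \in Q) = [|| a == y, a \in S | a \in R].
  have [->|nay] /= := eqVneq a y; first by rewrite yQ.
  by have := in_setU a S R; rewrite -defQ !inE nay.
have [yS yR] : y \notin S /\ y \notin R.
  have : y \notin Q :\ y by rewrite !inE eqxx.
  by rewrite defQ inE negb_or => /andP[].
have inR w : w \in Q -> w != y -> w \notin S -> w \in R.
  by rewrite QE => + nwy nwS; rewrite (negPf nwy) (negPf nwS).
have vR : v \in R.
  have [_ nvy] : v \in Q /\ v != y by move: vQy; rewrite !inE => /andP[].
  apply: inR => //; apply: contra vC => vS.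
  have [->|nvu] := eqVneq v u; first exact: component_self.
  apply: (component_closed (component_in uQy) (component_self uQy) vQy).
  by apply: clS; rewrite // eq_sym.
have touch S' R' : Q :\ y = S' :|: R' -> S' != set0 ->
    (forall a b, a \in S' -> b \in R' -> ~~ e a b) -> exists2 s, s \in S' & e y s.
  move=> def' /set0Pn[s sS'] sep'; have [/exists_inP//|no] := boolP [exists s in S', e y s].
  have S'Q a : a \in S' -> (a != y) && (a \in Q).
    by move=> aS'; have := in_setU a S' R'; rewrite -def' aS' !inE.
  have /andP[_ sQ] := S'Q s sS'.
  suff /S'Q : y \in S' by rewrite eqxx.
  apply: (ndE ndQ _ sS' sQ yQ) => b c bS' cQ ebc; have [cy|ncy] := eqVneq c y.
    by case/exists_inP: no; exists b; rewrite // e_sym -cy.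
  have : c \in Q :\ y by rewrite !inE ncy.
  by rewrite def' inE => /orP[//|/(sep' b c bS')]; rewrite ebc.
(* If u is the only neighbour of y in S, then S is {u}: otherwise u would separate the rest of S
   from y. *)
have [a [aS eya ua]] : exists a, [/\ a \in S, e y a & u != a \/ S = [set u]].
  have [/existsP[a /and3P[aS eya nua]]|no] := boolP [exists a, [&& a \in S, e y a & u != a]].
    by exists a; split=> //; left.
  have {}no a : a \in S -> e a y -> a = u.
    move=> aS eay; apply/eqP; rewrite eq_sym; apply: contraR no => nua.
    by apply/existsP; exists a; rewrite aS nua e_sym eay.
  have SE : S = [set u].
    apply/eqP; rewrite eqEsubset sub1set uS andbT; apply/subsetP => s sS.
    rewrite inE; apply: contraR yS => nsu.
    suff : y \in S :\ u by rewrite !inE => /andP[].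
    apply: (ndE (x := s) ndQu); rewrite ?inE ?nsu ?nyu ?QE ?sS ?orbT ?eqxx //=.
    move=> b c; rewrite !inE QE => /andP[nbu bS] /andP[ncu /or3P[/eqP->|->|cR]] ebc.
    - by case/eqP: nbu; apply: no.
    - by rewrite ncu.
    by have := sep b c bS cR; rewrite ebc.
  have [s sS eys] := touch S R defQ S0 sep.
  by exists s; split=> //; right.
have [b [v' [bR v'R v'Q [eyb exv' bv']]]] : exists b v', [/\ b \in R, v' \in R, v' \in Q &
    [/\ e y b, e x v' & b != v' \/ R = [set b]]].
  have [|||b bR eyb] := touch R S; rewrite 1?setUC //.
  have [/existsP[b' /and3P[b'R eyb' nb'v]]|no] := boolP [exists b, [&& b \in R, e y b & b != v]].
    by exists b', v; split=> //; split=> //; left.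
  have {}no c : c \in R -> e c y -> c = v.
    move=> cR ecy; apply/eqP; apply: contraR no => ncv.
    by apply/existsP; exists c; rewrite cR ncv e_sym ecy.
  have bv : b = v by apply: no; rewrite // e_sym.
  have [/existsP[r /andP[rR nrv]]|Rv] := boolP [exists r, (r \in R) && (r != v)]; last first.
    have RE : R = [set v].
      apply/eqP; rewrite eqEsubset sub1set vR andbT; apply/subsetP => r rR.
      by rewrite inE; apply: contraR Rv => nrv; apply/existsP; exists r; rewrite rR.
    by exists b, v; split=> //; split=> //; right; rewrite bv.
  have nvy : v != y by apply: contraNneq yR => <-.
  have nvu : v != u by apply: contraTneq vR => ->; rewrite (disjointFr dSR).
  (* Here v is the only neighbour of y in R and R has another vertex. So (c) can be applied to v in
     place of y, and it gives an exit v' in R different from v. *)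
  have artv : articulation e Q v.
    rewrite articulationE vQ; apply: (disconnected_closed (S := R :\ v) (x := r) (y := u)).
    - move=> c d; rewrite !inE QE => /andP[ncv cR] /andP[ndv /or3P[/eqP->|dS|->]] ecd.
      + by case/eqP: ncv; apply: no.
      + by have := sepC c d cR dS; rewrite ecd.
      by rewrite ndv.
    - by rewrite !inE nrv.
    - by rewrite !inE nrv QE rR !orbT.
    - by rewrite !inE eq_sym nvu.
    by rewrite !inE (disjointFr dSR uS) andbF.
  have [v' [v'Q exv' /in_different_componentsP[uQv v'Qv v'C]]] := condc v artv nvu.
  have uC := component_self uQv; have Cc := component_in uQv.
  have v'R : v' \in R.
    have inC c : c \in S -> c \in component_of e (Q :\ v) u.
      move=> cS; have [->//|ncu] := eqVneq c u; apply: (component_closed Cc uC).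
        by rewrite !inE QE cS orbT andbT; apply: contraTneq vR => <-; rewrite (disjointFr dSR).
      by apply: clS; rewrite // eq_sym.
    apply: inR => //; last by apply: contra v'C => /inC.
    apply: contraNneq v'C => ->; apply: (component_closed Cc (inC a aS)).
      by rewrite !inE yQ eq_sym nvy.
    by rewrite e_sym.
  exists b, v'; split=> //; split=> //; left; rewrite bv.
  by move: v'Qv; rewrite !inE eq_sym => /andP[].
exists v'; split=> //.
have hR := clique_set_ham clR bR v'R bv'; have hS := clique_set_ham clS uS aS ua.
have -> : Q = S :|: ([set y] :|: R).
  by apply/setP => c; rewrite QE !inE orbCA.
apply: (ham_enumU _ hS (_ : e a y)); last 1 first.
- by apply: (ham_enumU _ (ham_enum1 y) eyb hR); rewrite disjoints1.
- rewrite disjoint_sym -setI_eq0 setIUl; apply/eqP.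
  by rewrite (disjoint_setI0 (_ : [disjoint R & S])) 1?disjoint_sym // setU0; apply: disjoint_setI0; rewrite disjoints1.
by rewrite e_sym.
Qed.
(** * Sufficiency *)

Lemma setD1T x : ~: [set x] = [set: T] :\ x.
Proof. by rewrite setTD. Qed.

Definition articulations_ok :=
  (forall x, articulation e [set: T] x -> #|components e (~: [set x])| = 2) /\
  (forall x y z, articulation e [set: T] x -> articulation e [set: T] y ->
     articulation e [set: T] z -> ~ [/\ e x y, e y z & e x z]).

Lemma ham_path_fromP u : ham_path_from e u <-> exists w, ham (enum [set: T]) u w.
Proof.
split=> [[p [pth up all_p]]|[w [p [pth pT _]]]].
  exists (last u p), p; split=> //; apply: uniq_perm; rewrite ?enum_uniq // => z.
  by rewrite mem_enum in_setT all_p.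
exists p; split=> //; first by rewrite (perm_uniq pT) enum_uniq.
by move=> v; rewrite (perm_mem pT) mem_enum inE.
Qed.

Section Sufficiency.

Hypothesis free : four_K1_free e.
Hypothesis ndT : nd [set: T].

Lemma articulation_tail x Q : articulations_ok -> articulation e [set: T] x ->
  Q \in components e (~: [set x]) -> exists v w, [/\ v \in Q, e x v & ham (enum Q) v w].
Proof.
move=> [two notri] artx Qc.
have [v [vQ exv ndv]] := articulation_exit free artx two notri ndT Qc.
have [Q' [Q'c _ _ dQ]] := other_component (two x artx) Qc.
have [z zQ'] := component_ex Q'c.
have K : triple_free (mem Q).
  apply: component_triple_free free Qc (subsetP (component_sub Q'c) _ zQ') _.
  by rewrite (disjointFl dQ).
have [w hw] := triple_free_ham K vQ (component_nd Qc) ndv.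
by exists v, w.
Qed.

Lemma articulation_glue x Q v : articulations_ok -> articulation e [set: T] x ->
    Q \in components e (~: [set x]) -> v \in Q -> e x v ->
  forall u, ham (enum Q) u v -> exists w, ham (enum [set: T]) u w.
Proof.
move=> ok artx Qc vQ exv u hQ; have [two notri] := ok.
have [Q' [Q'c _ defA dQ]] := other_component (two x artx) Qc.
have [v' [w [v'Q' exv' hQ']]] := articulation_tail ok artx Q'c.
have xA : x \notin Q :|: Q' by rewrite -defA !inE eqxx.
move: xA; rewrite inE negb_or => /andP[xQ xQ'].
exists w; have -> : [set: T] = Q :|: ([set x] :|: Q').
  apply/setP => z; have := in_setU z Q Q'; rewrite -defA !inE orbCA => <-.
  by rewrite orbN.
apply: (ham_enumU _ hQ (_ : e v x)); last 1 first.
- by apply: (ham_enumU _ (ham_enum1 x) exv' hQ'); rewrite disjoints1.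
- rewrite disjoint_sym -setI_eq0 setIUl; apply/eqP.
  rewrite (disjoint_setI0 (_ : [disjoint Q' & Q])) 1?disjoint_sym // setU0.
  by apply: disjoint_setI0; rewrite disjoints1.
by rewrite e_sym.
Qed.

Lemma has_ham_path_suff (u0 : T) : articulations_ok -> has_ham_path e.
Proof.
move=> ok; have [/existsP[x artx]|noart] := boolP [exists x, articulation e [set: T] x].
  have dx : disconnected e (~: [set x]) by move: artx; rewrite articulationE inE setD1T.
  have [S [R [defx _ /set0Pn[z zS] _ _]]] := separation dx.
  have zx : z \in ~: [set x] by rewrite defx inE zS.
  have [v [w [vQ exv hw]]] := articulation_tail ok artx (component_in zx).
  have [w' hw'] := articulation_glue ok artx (component_in zx) vQ exv (ham_rev hw).
  by exists w; apply/ham_path_fromP; exists w'.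
have [|u [w hw]] := ham_exists free ndT _ u0.
  move=> x; apply/negP => dx; case/existsP: noart; exists x.
  by rewrite articulationE inE.
by exists u; apply/ham_path_fromP; exists w.
Qed.

Lemma articulation_start u x : articulations_ok -> articulation e [set: T] x -> x != u ->
    ~~ articulation e [set: T] u ->
    let Qu := component_of e (~: [set x]) u in
    (~~ k_connected e 2 Qu -> forall y, articulation e Qu y -> y != u -> exists v,
       [/\ v \in Qu, e x v & in_different_components e (Qu :\ y) u v]) ->
    (k_connected e 2 Qu -> exists v,
       [/\ v \in Qu, e x v, v != u & ~~ min_vertex_cut e Qu [set u; v]]) ->
    #|components e (~: [set u; x])| <= 2 ->
  exists w, ham (enum [set: T]) u w.
Proof.
move=> ok artx nxu nartu Qu condc condd conde; have [two notri] := ok.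
have ux : u \in ~: [set x] by rewrite !inE eq_sym.
have Qc : Qu \in components e (~: [set x]) := component_in ux.
have uQ : u \in Qu := component_self ux.
have ndQ := component_nd Qc.
have [Q' [Q'c _ defA dQ]] := other_component (two x artx) Qc.
have [z zQ'] := component_ex Q'c.
have xA : x \notin Qu :|: Q' by rewrite -defA !inE eqxx.
move: xA; rewrite inE negb_or => /andP[xQ xQ'].
have K : triple_free (mem Qu).
  apply: component_triple_free free Qc (subsetP (component_sub Q'c) _ zQ') _.
  by rewrite (disjointFl dQ).
suff [v [vQ exv hQ]] : exists v, [/\ v \in Qu, e x v & ham (enum Qu) u v].
  exact: articulation_glue ok artx Qc vQ exv u hQ.
have nbQ a b : a \in Qu -> e a b -> b != x -> b \in Qu.
  by move=> aQ eab nbx; apply: (component_closed Qc aQ _ eab); rewrite !inE.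
(* For cliques [k_connected] depends on the order rather than on cuts, so they are treated apart. *)
have [cl|ncl] := boolP (clique e Qu).
  have clQ : {in Qu &, forall a b, a != b -> e a b}.
    by move=> a b aQ bQ nab; move/forall_inP/(_ a aQ)/forall_inP/(_ b bQ)/implyP: cl; apply.
  suff [v [vQ exv hv]] : exists v, [/\ v \in Qu, e x v & u != v \/ Qu = [set u]].
    by exists v; split=> //; apply: clique_set_ham.
  have [/existsP[v /and3P[vQ exv nuv]]|no] := boolP [exists v, [&& v \in Qu, e x v & u != v]].
    by exists v; split=> //; left.
  have {}no v : v \in Qu -> e v x -> v = u.
    move=> vQ evx; apply/eqP; rewrite eq_sym; apply: contraR no => nuv.
    by apply/existsP; exists v; rewrite vQ nuv e_sym evx.
  (* Otherwise u would separate the rest of Qu from x, against (b). *)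
  have QE : Qu = [set u].
    apply/eqP; rewrite eqEsubset sub1set uQ andbT; apply/subsetP => s sQ.
    rewrite inE; apply: contraR nartu => nsu; rewrite articulationE inE.
    apply: (disconnected_closed (S := Qu :\ u) (x := s) (y := x)).
    - move=> a b; rewrite !inE andbT => /andP[nau aQ] nbu eab; rewrite nbu.
      apply: (nbQ a) => //; apply: contraNneq nau => bx; apply/eqP.
      by apply: no; rewrite -?bx.
    - by rewrite !inE nsu.
    - by rewrite !inE nsu.
    - by rewrite !inE nxu.
    by rewrite !inE (negPf xQ) andbF.
  exists u; split=> //; last by right.
  rewrite e_sym; apply: contraT => nux; case/negP: xQ.
  apply: (ndE ndT _ uQ); rewrite ?inE // => a b aQ _ eab; apply: (nbQ a) => //.
  apply: contraNneq nux => bx; move: aQ eab; rewrite QE inE bx => /eqP->.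
  exact.
(* Otherwise its two parts and the other component of G - x would give three components of G - {u,
   x}, against (e). *)
have ndQu : nd (Qu :\ u).
  apply/negP => /separation[S [R [defQ dSR /set0Pn[s sS] /set0Pn[r rR] sep]]].
  have SRQ a : a \in S :|: R -> (a \in Qu) && (a != u) by rewrite -defQ !inE andbC.
  have SE a : a \in S -> (a \in Qu) && (a != u) by move=> aS; apply: SRQ; rewrite inE aS.
  have RE a : a \in R -> (a \in Qu) && (a != u) by move=> aR; apply: SRQ; rewrite inE aR orbT.
  have closedG S' R' : Qu :\ u = S' :|: R' -> (forall a b, a \in S' -> b \in R' -> ~~ e a b) ->
      (forall a, a \in S' -> a \in Qu) -> closed_in (~: [set u; x]) S'.
    move=> def' sep' S'Q a b aS'; rewrite !inE negb_or => /andP[nbu nbx] eab.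
    have : b \in Qu :\ u by rewrite !inE nbu (nbQ a b) // S'Q.
    by rewrite def' inE => /orP[//|/(sep' a b aS')]; rewrite eab.
  have cS : closed_in (~: [set u; x]) S.
    by apply: (closedG S R) => // a /SE/andP[].
  have cR : closed_in (~: [set u; x]) R.
    apply: (closedG R S); first by rewrite setUC.
      by move=> a b aR bS; rewrite e_sym sep.
    by move=> a /RE/andP[].
  have QA a : (a \in Qu) && (a != u) -> a \in ~: [set u; x].
    by case/andP=> aQ nau; rewrite !inE (negPf nau) /=; apply: contraNneq xQ => <-.
  have zA : z \in ~: [set u; x].
    rewrite !inE negb_or; apply/andP; split.
      by apply: contraTneq zQ' => ->; rewrite (disjointFr dQ).
    by apply: contraNneq xQ' => <-.
  have zQ : z \notin Qu by rewrite (disjointFl dQ).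
  have := components_ge3 cS cR sS rR zA (QA _ (SE _ sS)) (QA _ (RE _ rR)).
  rewrite (disjointFl dSR rR) => /(_ isT); rewrite leqNgt ltnS conde /= => ge3.
  suff : false by []; apply: ge3.
    by apply/negP => /SE/andP[zQ1]; rewrite zQ1 in zQ.
  by apply/negP => /RE/andP[zQ1]; rewrite zQ1 in zQ.
have [k2|nk2] := boolP (k_connected e 2 Qu).
  have [v [vQ exv nvu nmin]] := condd k2; exists v; split=> //.
  have [_ ndx] := k_connected2_nd k2.
  apply: triple_free_ham_ends => //; first by rewrite eq_sym.
  (* In a 2-connected graph a vertex cut of two vertices is minimum. *)
  apply/negP => dQ2; case/negP: nmin; rewrite /min_vertex_cut.
  have cut : vertex_cut e Qu [set u; v].
    by rewrite /vertex_cut dQ2 andbT; apply/subsetP => a; rewrite !inE => /orP[]/eqP->.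
  have := connectivity_le cut; rewrite cut eqn_leq cards2 eq_sym nvu => -> /=.
  by rewrite andbT.
have [y arty] : exists y, articulation e Qu y.
  apply/existsP; apply: contraR nk2 => noart; apply: nd_k_connected2 => // y yQ.
  apply/negP => dy; case/existsP: noart; exists y; by rewrite articulationE yQ.
have nyu : y != u.
  by apply: contraTneq arty => ->; rewrite articulationE negb_and (ndQu : ~~ _) orbT.
exact: exit_two_cliques K ndQ uQ ndQu (condc nk2) arty nyu.
Qed.

(** The last hypothesis is (f) for y = u turned around: it supplies the vertex v through which x
    enters Q2. *)
Lemma two_connected_start u : (forall x, nd ([set: T] :\ x)) ->
    (forall x, #|components e (~: [set u; x])| <= 2) ->
    (k_connected e 2 [set: T] -> forall x, min_vertex_cut e [set: T] [set x; u] ->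
       #|components e (~: [set x; u])| = 2 ->
       forall Q1 Q2, components e (~: [set x; u]) = [set Q1; Q2] -> clique e Q1 ->
       exists2 v, v \in Q2 & e x v && ~~ articulation e Q2 v) ->
  exists w, ham (enum [set: T]) u w.
Proof.
move=> ndTx conde condf; have [//|[x nxu]] := ham_or_cut free ndT ndTx u.
rewrite setTD => dux; have cut : vertex_cut e [set: T] [set x; u].
  by rewrite /vertex_cut subsetT setTD setUC.
have k2 := nd_k_connected2 (vertex_cut_nonclique cut) ndT (fun x _ => ndTx x).
have mcut : min_vertex_cut e [set: T] [set x; u].
  have := connectivity_le cut; rewrite /min_vertex_cut cut eqn_leq cards2 nxu => -> /=.
  by rewrite andbT.
have c2 : #|components e (~: [set x; u])| = 2.
  by apply/eqP; rewrite eqn_leq setUC conde.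
have {condf} condf := condf k2 x mcut c2.
have main Q1 : Q1 \in components e (~: [set x; u]) -> clique e Q1 ->
    exists w, ham (enum [set: T]) u w.
  move=> Q1c cl; have [Q2 [Q2c nQ defA dQ]] := other_component c2 Q1c.
  have defc : components e (~: [set x; u]) = [set Q1; Q2].
    apply/eqP; rewrite eq_sym eqEcard c2 cards2 nQ andbT.
    by apply/subsetP => Q; rewrite !inE => /orP[]/eqP->.
  have [v vQ2 /andP[exv nartv]] := condf Q1 Q2 defc cl.
  have ndv : nd (Q2 :\ v) by move: nartv; rewrite articulationE vQ2.
  have [q1 q1Q] := component_ex Q1c.
  have K : triple_free (mem Q2).
    apply: component_triple_free free Q2c (subsetP (component_sub Q1c) _ q1Q) _.
    by rewrite (disjointFr dQ).
  have [w hQ2] := triple_free_ham K vQ2 (component_nd Q2c) ndv.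
  have clQ : {in Q1 &, forall a b, a != b -> e a b}.
    by move=> a b aQ bQ nab; move/forall_inP/(_ a aQ)/forall_inP/(_ b bQ)/implyP: cl; apply.
  have xuA a : a \in [set x; u] -> (a \notin Q1) && (a \notin Q2).
    by move=> axu; rewrite -negb_or -in_setU -defA inE axu.
  have /andP[xQ1 xQ2] : (x \notin Q1) && (x \notin Q2) by apply: xuA; rewrite !inE eqxx.
  have /andP[uQ1 uQ2] : (u \notin Q1) && (u \notin Q2) by apply: xuA; rewrite !inE eqxx orbT.
  have nbQ a b : a \in Q1 -> e a b -> [|| b == x, b == u | b \in Q1].
    move=> aQ eab; rewrite orbA; have [//|nb] /= := boolP ((b == x) || (b == u)).
    by apply: (component_closed Q1c aQ _ eab); rewrite !inE.
  (* Both u and x have neighbours in Q1, since neither of them alone separates G. *)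
  have touch y z : y \notin Q1 -> z \notin Q1 -> y != z ->
      (forall a b, a \in Q1 -> e a b -> [|| b == z, b == y | b \in Q1]) -> exists2 a, a \in Q1 & e y a.
    move=> yQ zQ nyz nbQ'; have [/exists_inP//|no] := boolP [exists a in Q1, e y a].
    case/negP: yQ; have nq1z : q1 != z by apply: contraNneq zQ => <-.
    apply: (ndE (ndTx z) _ q1Q); rewrite ?inE ?nyz ?nq1z // => a b aQ.
    rewrite !inE andbT => nbz eab; have := nbQ' a b aQ eab.
    rewrite (negPf nbz) /= => /orP[/eqP bY|//].
    by case/exists_inP: no; exists a; rewrite // e_sym -bY.
  have [|w1 w1Q euw1] := touch u x uQ1 xQ1 (_ : u != x) nbQ; first by rewrite eq_sym.
  have [w2 w2Q exw2] := touch x u xQ1 uQ1 nxu (fun a b aQ eab => etrans (orbCA _ _ _) (nbQ a b aQ eab)).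
  (* If u and x share their only neighbour w1 in Q1, then Q1 is {w1}, as w1 is not an articulation
     point. *)
  have [a [b [aQ bQ [eua exb nab]]]] : exists a b, [/\ a \in Q1, b \in Q1 &
      [/\ e u a, e x b & a != b \/ Q1 = [set a]]].
    have [w12|nw] := eqVneq w1 w2; last by exists w1, w2; split=> //; split=> //; left.
    rewrite -{w2 w2Q}w12 in exw2 *.
    have [/existsP[a /and3P[aQ na /orP[eua|exa]]]|no] :=
        boolP [exists a, [&& a \in Q1, a != w1 & e u a || e x a]].
    - by exists a, w1; split=> //; split=> //; left.
    - by exists w1, a; split=> //; split=> //; left; rewrite eq_sym.
    exists w1, w1; split=> //; split=> //; right.
    apply/eqP; rewrite eqEsubset sub1set w1Q andbT; apply/subsetP => r rQ.
    have nxw : x != w1 by apply: contraNneq xQ1 => ->.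
    rewrite inE; apply: contraR xQ1 => nrw.
    suff : x \in Q1 :\ w1 by rewrite !inE => /andP[].
    apply: (ndE (x := r) (ndTx w1)); rewrite ?inE ?nrw ?nxw ?rQ // => c d.
    rewrite !inE andbT => /andP[ncw cQ] ndw ecd; rewrite ndw /=.
    have /or3P[/eqP dx|/eqP du|//] := nbQ c d cQ ecd.
      by case/existsP: no; exists c; rewrite cQ ncw (e_sym x) -dx ecd orbT.
    by case/existsP: no; exists c; rewrite cQ ncw (e_sym u) -du ecd.
  have hQ1 := clique_set_ham clQ aQ bQ nab.
  exists w; have -> : [set: T] = [set u] :|: (Q1 :|: ([set x] :|: Q2)).
    apply/setP => z; have := in_setU z Q1 Q2; rewrite -defA !inE.
    by case: (z == u); case: (z == x); case: (z \in Q1); case: (z \in Q2).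
  have hx : ham (enum ([set x] :|: Q2)) x w.
    by apply: (ham_enumU _ (ham_enum1 x) exv hQ2); rewrite disjoints1.
  have hQx : ham (enum (Q1 :|: ([set x] :|: Q2))) a w.
    apply: (ham_enumU _ hQ1 (_ : e b x) hx); last by rewrite e_sym.
    rewrite disjoint_sym -setI_eq0 setIUl setU_eq0 !setI_eq0 disjoints1 xQ1.
    by rewrite disjoint_sym.
  apply: (ham_enumU _ (ham_enum1 u) eua hQx).
  by rewrite disjoints1 !inE (negPf uQ1) (negPf uQ2) eq_sym (negPf nxu).
(* One of the two components is a clique: non-adjacent pairs in both would form a $4K_1$. *)
have /card_gt1P[Q1 [Q2 [Q1c Q2c nQ]]] : 1 < #|components e (~: [set x; u])| by rewrite c2.
have [cl1|] := boolP (clique e Q1); first exact: main Q1c cl1.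
have [cl2 _|] := boolP (clique e Q2); first exact: main Q2c cl2.
have nonadj Q : ~~ clique e Q -> exists a b, [/\ a \in Q, b \in Q, a != b & ~~ e a b].
  rewrite negb_forall_in => /exists_inP[a aQ]; rewrite negb_forall_in => /exists_inP[b bQ].
  by rewrite negb_imply => /andP[nab neab]; exists a, b.
case/nonadj=> c [d [cQ dQ ncd necd]] /nonadj[a [b [aQ bQ nab neab]]].
have sep y z : y \in Q1 -> z \in Q2 -> (y != z) && ~~ e y z.
  move=> yQ zQ; have zQ1 : z \notin Q1.
    by apply: contra nQ => zQ1; rewrite (component_unique Q1c zQ1) (component_unique Q2c zQ).
  apply/andP; split; first by apply: contraNneq zQ1 => <-.
  apply: contra zQ1; apply: (component_closed Q1c yQ).
  exact: (subsetP (component_sub Q2c)).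
have [/andP[n1 e1] /andP[n2 e2]] := (sep a c aQ cQ, sep a d aQ dQ).
have [/andP[n3 e3] /andP[n4 e4]] := (sep b c bQ cQ, sep b d bQ dQ).
have := four_K1_freeP free (x := a) (y := b) (z := c) (w := d).
rewrite (negPf e3) (negPf e4) (negPf necd) neab e1 e2 /= !inE !negb_or nab n1 n2 n3 n4 ncd.
by move=> /(_ isT isT isT isT).
Qed.

End Sufficiency.
(** * Necessity *)

Lemma sorted_nd s : sorted e s -> nd [set z in s].
Proof.
case: s => [_|x s /= pth].
  by apply/disconnectedP => -[S [x [y [_ _ _]]]]; rewrite !inE.
apply: (nd_from (v := x)) => [|S cS xS y]; first by rewrite !inE eqxx.
rewrite !inE => /predU1P[->//|].
have : {subset s <= [set z in x :: s]} by move=> z zs; rewrite !inE zs orbT.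
move: [set z in x :: s] cS => A cS; elim: s x pth xS => //= z s IH x /andP[exz pth] xS sA.
have zS : z \in S by apply: (cS x) => //; apply: sA; apply: mem_head.
rewrite inE => /predU1P[->//|]; apply: (IH z) => // w ws.
by apply: sA; rewrite inE ws orbT.
Qed.

Lemma sorted_split s1 x s2 : sorted e (s1 ++ x :: s2) -> sorted e s1 /\ sorted e s2.
Proof.
by move=> /cat_sorted2[-> /path_sorted].
Qed.

Lemma ndU S R x y : nd S -> nd R -> x \in S -> y \in R -> e x y -> nd (S :|: R).
Proof.
move=> ndS ndR xS yR exy; apply: (nd_from (v := x)) => [|U cU xU z]; first by rewrite inE xS.
have cS : closed_in S U by move=> a b aU bS; apply: cU; rewrite // inE bS.
have cR : closed_in R U by move=> a b aU bR; apply: cU; rewrite // inE bR orbT.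
rewrite inE => /orP[zS|zR]; first exact: (ndE ndS cS xU xS zS).
by apply: (ndE ndR cR _ yR zR); apply: (cU x); rewrite // inE yR orbT.
Qed.

Section Necessity.

Variable s : seq T.
Hypotheses (ss : sorted e s) (us : uniq s) (all_s : forall v, v \in s).

Lemma split_set s1 x s2 : s = s1 ++ x :: s2 ->
  ~: [set x] = [set z in s1] :|: [set z in s2].
Proof.
move=> eqs; apply/setP => z; rewrite !inE.
have := all_s z; have := us; rewrite eqs uniq_catC /= !mem_cat inE negb_or => /andP[/andP[x2 x1] _].
have [->|_ /=] := eqVneq z x; last by [].
by rewrite (negPf x1) (negPf x2).
Qed.

Lemma split_ex x : exists s1 s2, s = s1 ++ x :: s2.
Proof. by case/splitPr: (all_s x) => s1 s2; exists s1, s2. Qed.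

Lemma components_le2_vertex x : #|components e (~: [set x])| <= 2.
Proof.
have [s1 [s2 eqs]] := split_ex x; have := ss; rewrite eqs => /sorted_split[ss1 ss2].
exact: components_le2 (sorted_nd ss1) (sorted_nd ss2) (split_set eqs).
Qed.

(** The edge x z joins the two segments left after deleting y. *)
Lemma articulation_between x y z : index x s < index y s < index z s -> e x z ->
  ~~ articulation e [set: T] y.
Proof.
case/andP=> xy yz exz; have [s1 [s2 eqs]] := split_ex y.
have us' := us; rewrite eqs in us'.
have ys1 : y \notin s1 by move: us'; rewrite uniq_catC /= mem_cat negb_or => /andP[/andP[]].
have idx : index y s = size s1 by rewrite eqs index_cat (negPf ys1) /= eqxx addn0.
have xs1 : x \in s1.
  by move: xy; rewrite idx eqs index_cat; case: ifP => // _; rewrite ltnNge leq_addr.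
have zs2 : z \in s2.
  have := all_s z; rewrite eqs mem_cat inE => /or3P[zs1|/eqP zy|//].
    by move: yz; rewrite idx eqs index_cat zs1 ltnNge ltnW // index_mem.
  by rewrite zy ltnn in yz.
have := ss; rewrite eqs => /sorted_split[/sorted_nd nd1 /sorted_nd nd2].
rewrite articulationE inE -setD1T (split_set eqs).
by apply: (ndU nd1 nd2 (x := x) (y := z)); rewrite ?inE.
Qed.

(** In a triangle, the vertex in the middle along the path is bypassed by the edge between the other
    two; [lia] goes through the orders. *)
Lemma sorted_articulations_ok : articulations_ok.
Proof.
split=> [x artx|x y z ax ay az [exy eyz exz]].
  apply/eqP; rewrite eqn_leq components_le2_vertex.
  by move: artx; rewrite articulationE inE -setD1T.
have btw a b c : articulation e [set: T] b -> e a c -> ~~ (index a s < index b s < index c s).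
  by move=> ab eac; apply: contraL ab => /articulation_between; apply.
have neq a b : e a b -> index a s != index b s.
  move=> eab; apply/eqP => idx.
  have ab : a = b by rewrite -[LHS](nth_index a (all_s a)) idx nth_index.
  by rewrite ab e_irr in eab.
have [[ezx eyx] ezy] : (e z x * e y x * e z y) by rewrite !(e_sym z) (e_sym y x).
have h1 := btw x y z ay exz; have h2 := btw x z y az exy; have h3 := btw y x z ax eyz.
have h4 := btw z y x ay ezx; have h5 := btw y z x az eyx; have h6 := btw z x y ax ezy.
have nxy := neq _ _ exy; have nyz := neq _ _ eyz; have nxz := neq _ _ exz.
move: nxy nyz nxz h1 h2 h3 h4 h5 h6; move: (index x s) (index y s) (index z s).
by clear; lia.
Qed.

End Necessity.

(** * Necessary conditions for a prescribed start *)

Section StartNecessity.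

Variables (u : T) (p : seq T).
Hypotheses (pth : path e u p) (up : uniq (u :: p)) (all_p : forall v, v \in u :: p).

Let sp : sorted e p. Proof. exact: path_sorted pth. Qed.

Lemma start_not_articulation : ~~ articulation e [set: T] u.
Proof.
rewrite articulationE inE -setD1T (split_set up all_p (s1 := [::]) (erefl _)).
have -> : [set z in [::]] = set0 :> {set T} by apply/setP => z; rewrite !inE.
by rewrite set0U; apply: sorted_nd.
Qed.

Lemma start_split x : x != u -> exists s1 s2, p = s1 ++ x :: s2.
Proof.
move=> nxu; have := all_p x; rewrite inE (negPf nxu) => /splitPr[s1 s2].
by exists s1, s2.
Qed.

Lemma split_set2 s1 x s2 : p = s1 ++ x :: s2 ->
  ~: [set u; x] = [set z in s1] :|: [set z in s2].
Proof.
move=> eqp; apply/setP => z; have := split_set up all_p (s1 := u :: s1) (congr1 (cons u) eqp).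
move/setP/(_ z); rewrite !inE negb_or => ->; have [->|//] := eqVneq z u.
rewrite /=; move: up; rewrite eqp /= mem_cat inE !negb_or => /andP[/and3P[n1 _ n2] _].
by rewrite (negPf n1) (negPf n2).
Qed.

Lemma components_le2_pair x : #|components e (~: [set u; x])| <= 2.
Proof.
have [->|/start_split[s1 [s2 eqp]]] := eqVneq x u.
  by rewrite setUid; apply: (@components_le2_vertex (u :: p)).
have := sp; rewrite eqp => /sorted_split[/sorted_nd nd1 /sorted_nd nd2].
exact: components_le2 nd1 nd2 (split_set2 eqp).
Qed.

(** If the component of u also met the segment after x, it would be all of G - x, which is
    disconnected. *)
Lemma start_component s1 x s2 : articulation e [set: T] x -> p = s1 ++ x :: s2 ->
  component_of e (~: [set x]) u = [set z in u :: s1].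
Proof.
move=> artx eqp; have defA := split_set up all_p (s1 := u :: s1) (congr1 (cons u) eqp).
have uA : u \in ~: [set x] by rewrite defA !inE eqxx.
have Qc := component_in uA; have uQ := component_self uA.
have spp : sorted e ((u :: s1) ++ x :: s2) by rewrite cat_cons -eqp.
have [/sorted_nd nd1 /sorted_nd nd2] := sorted_split spp.
have LQ : [set z in u :: s1] \subset component_of e (~: [set x]) u.
  apply: nd_component Qc nd1 _ _; first by rewrite defA subsetUl.
  by apply/pred0Pn; exists u; rewrite /= !inE eqxx uQ.
apply/eqP; rewrite eqEsubset LQ andbT.
have [dis|meet] := boolP [disjoint [set z in s2] & component_of e (~: [set x]) u].
  apply/subsetP => z zQ; have := subsetP (component_sub Qc) _ zQ.
  by rewrite defA in_setU => /orP[//|zR]; rewrite (disjointFr dis zR) in zQ.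
have RQ := nd_component Qc nd2 (_ : _ \subset _) meet.
have QA : component_of e (~: [set x]) u = ~: [set x].
  apply/eqP; rewrite eqEsubset (component_sub Qc) {1}defA subUset LQ RQ //.
  by rewrite defA subsetUr.
have := component_nd Qc; rewrite QA /nd.
by move: artx; rewrite articulationE inE -setD1T /= => ->.
Qed.

Lemma last_split (s1 s2 : seq T) x z : path e z (s1 ++ x :: s2) -> e x (last z s1).
Proof. by rewrite cat_path e_sym => /and3P[]. Qed.

(** The predecessor of x serves as v: on the path y lies between u and v. If u and v were in one
    component of Qu - y, both segments around y would be, and y would not be an articulation
    point. *)
Lemma start_cond_c x y : articulation e [set: T] x -> x != u ->
    let Qu := component_of e (~: [set x]) u in articulation e Qu y -> y != u ->
  exists v, [/\ v \in Qu, e x v & in_different_components e (Qu :\ y) u v].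
Proof.
move=> artx nxu; have [s1 [s2 eqp]] := start_split nxu.
rewrite (start_component artx eqp) /= articulationE => /andP[yQ dQ] nyu.
have ys1 : y \in s1 by move: yQ; rewrite !inE (negPf nyu).
case/splitPr: ys1 eqp dQ yQ => t1 t2 eqp dQ _.
have us1 : uniq (u :: t1 ++ y :: t2).
  by move: up; rewrite eqp -cat_cons cat_uniq => /andP[].
have defQ : [set z in u :: t1 ++ y :: t2] :\ y = [set z in u :: t1] :|: [set z in t2].
  apply/setP => z; rewrite !(inE, mem_cat).
  have := us1; rewrite -cat_cons uniq_catC /= mem_cat inE !negb_or => /andP[/and3P[n2 nu n1] _].
  have [->|_] := eqVneq z y; last by rewrite orbA.
  by rewrite (negPf n1) (negPf n2) (negPf nu).
have spp : sorted e ((u :: t1) ++ y :: t2).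
  by move: pth; rewrite eqp cat_path => /andP[].
have [/sorted_nd nd1 st2] := sorted_split spp; have nd2 := sorted_nd st2.
have t2_0 : t2 != [::].
  apply: contraTneq dQ => t20; rewrite defQ t20.
  have -> : [set z in [::]] = set0 :> {set T} by apply/setP => z; rewrite !inE.
  by rewrite setU0.
have vl : last u (t1 ++ y :: t2) \in t2.
  by rewrite last_cat /=; case: (t2) t2_0 => // c t3 _; apply: (mem_last c t3).
exists (last u (t1 ++ y :: t2)); split.
- by rewrite !(inE, mem_cat) vl !orbT.
- by apply: (@last_split _ s2); rewrite -eqp.
set v := last _ _ in vl *; set A := _ :\ y in defQ dQ *.
have uA : u \in A by rewrite defQ !inE eqxx.
have vA : v \in A by rewrite defQ !inE vl orbT.
exists (component_of e A u), (component_of e A v); rewrite !component_in ?component_self //.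
split=> //; apply: contraTneq dQ => eqC; have Cc := component_in uA.
have uC := component_self uA; have vC : v \in component_of e A u by rewrite eqC component_self.
suff -> : A = component_of e A u by exact: (component_nd Cc).
apply/eqP; rewrite eqEsubset (component_sub Cc) andbT {1}defQ subUset.
apply/andP; split.
  apply: (nd_component Cc nd1); first by rewrite defQ subsetUl.
  by apply/pred0Pn; exists u; rewrite /= uC !inE eqxx.
apply: (nd_component Cc nd2); first by rewrite defQ subsetUr.
by apply/pred0Pn; exists v; rewrite /= vC inE vl.
Qed.

Lemma rcons_setD1 (s : seq T) v : uniq (rcons s v) -> [set z in rcons s v] :\ v = [set z in s].
Proof.
rewrite rcons_uniq => /andP[vs _]; apply/setP => z; rewrite !inE mem_rcons inE.
by have [->|] := eqVneq z v; rewrite ?(negPf vs).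
Qed.

(** With v the predecessor of x, the set Qu minus u and v is the segment strictly between them,
    which is connected. *)
Lemma start_cond_d x : articulation e [set: T] x -> x != u ->
    let Qu := component_of e (~: [set x]) u in k_connected e 2 Qu ->
  exists v, [/\ v \in Qu, e x v, v != u & ~~ min_vertex_cut e Qu [set u; v]].
Proof.
move=> artx nxu; have [s1 [s2 eqp]] := start_split nxu.
rewrite (start_component artx eqp) => /= k2.
have exv : e x (last u s1) by apply: (@last_split _ s2); rewrite -eqp.
(* If x directly follows u, then Qu is {u}, a clique of connectivity 0. *)
case/lastP: s1 eqp k2 exv => [|t v] eqp k2 exv.
  move: k2; rewrite /k_connected /connectivity.
  have -> : clique e [set z in [:: u]].
    apply/forall_inP => a; rewrite !inE => /eqP->; apply/forall_inP => b.
    by rewrite !inE => /eqP->; rewrite eqxx.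
  by rewrite cardsE (card_uniqP _).
rewrite last_rcons in exv; have uq : uniq (u :: rcons t v).
  by move: up; rewrite eqp -cat_cons cat_uniq => /andP[].
have /andP[nu uqt] := uq; have nvu : v != u.
  by apply: contraNneq nu => <-; rewrite mem_rcons mem_head.
exists v; split=> //; first by rewrite !inE mem_rcons mem_head orbT.
apply/negP => /andP[/andP[_]].
have -> : [set z in u :: rcons t v] :\: [set u; v] = [set z in t].
  rewrite -setDDl -(rcons_setD1 uqt); congr (_ :\ v); apply/setP => z; rewrite !inE.
  by have [->|] := eqVneq z u; rewrite ?(negPf nu).
suff /sorted_nd/negPf-> : sorted e t by [].
by move: pth; rewrite eqp cat_path rcons_path => /andP[/andP[/path_sorted]].
Qed.

(** Q2 is the segment just before or just after x. Its end next to x is the witness: removing an end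
    of a segment keeps it connected. *)
Lemma start_cond_f x Q1 Q2 : x != u -> #|components e (~: [set x; u])| = 2 ->
    components e (~: [set x; u]) = [set Q1; Q2] ->
  exists2 v, v \in Q2 & e x v && ~~ articulation e Q2 v.
Proof.
move=> nxu c2 defc; have [s1 [s2 eqp]] := start_split nxu.
have Qc : Q2 \in components e (~: [set x; u]) by rewrite defc !inE eqxx orbT.
have defA := split_set2 eqp; rewrite setUC in defA.
have := sp; rewrite eqp => /sorted_split[ss1 ss2].
have [nd1 nd2] := (sorted_nd ss1, sorted_nd ss2).
have [q qQ] := component_ex Qc.
have up' : uniq (s1 ++ x :: s2) by move: up; rewrite eqp => /andP[].
have whole : ~: [set x; u] != Q2.
  apply/eqP => def; have := component_nd Qc; rewrite -def /nd /disconnected c2.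
  by [].
have cover (L R : {set T}) : ~: [set x; u] = L :|: R -> nd L -> nd R -> q \in L -> Q2 = L.
  move=> defLR ndL ndR qL; have [LA RA] : L \subset ~: [set x; u] /\ R \subset ~: [set x; u].
    by rewrite defLR subsetUl subsetUr.
  have LQ : L \subset Q2.
    by apply: nd_component Qc ndL LA _; apply/pred0Pn; exists q; rewrite /= qL.
  have [dis|meet] := boolP [disjoint R & Q2].
    apply/eqP; rewrite eqEsubset LQ andbT; apply/subsetP => z zQ.
    have := subsetP (component_sub Qc) _ zQ.
    by rewrite defLR in_setU => /orP[//|zR]; rewrite (disjointFr dis zR) in zQ.
  have RQ := nd_component Qc ndR RA meet; case/eqP: whole.
  by apply/eqP; rewrite eqEsubset (component_sub Qc) andbT defLR subUset LQ RQ.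
have := subsetP (component_sub Qc) _ qQ; rewrite defA in_setU => /orP[q1|q2].
  have QE := cover _ _ defA nd1 nd2 q1.
  have exv : e x (last u s1) by apply: (@last_split _ s2); rewrite -eqp.
  case/lastP: s1 {eqp defA nd1 cover} ss1 up' q1 QE exv => [|t v] ss1 up' q1 QE exv.
    by rewrite inE in q1.
  rewrite last_rcons in exv; exists v; first by rewrite QE inE mem_rcons mem_head.
  rewrite exv articulationE negb_and /=; apply/orP; right.
  rewrite QE rcons_setD1; last by move: up'; rewrite cat_uniq => /andP[].
  by apply: sorted_nd; move: ss1; rewrite -cats1 => /cat_sorted2[].
have QE : Q2 = [set z in s2] by apply: (cover _ [set z in s1] _ nd2 nd1 q2); rewrite [RHS]setUC.
case: s2 {defA nd2 cover} eqp ss2 up' q2 QE => [|v t] eqp ss2 up' q2 QE.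
  by rewrite inE in q2.
exists v; first by rewrite QE !inE eqxx.
have -> : e x v by move: pth; rewrite eqp cat_path => /and3P[_ _ /andP[]].
rewrite articulationE negb_and /=; apply/orP; right.
have -> : Q2 :\ v = [set z in t].
  rewrite QE; apply/setP => z; rewrite !inE; have [->|//] := eqVneq z v.
  by move: up'; rewrite cat_uniq /= => /and5P[_ _ _ /negPf->].
by apply: sorted_nd; apply: path_sorted ss2.
Qed.

End StartNecessity.
End Graph.

Theorem theorem5 (T : finType) (e : rel T)
    (e_sym : symmetric e) (e_irr : irreflexive e)
    (G_conn : connected e [set: T]) (G_free : four_K1_free e) (u : T) :
  (* the equivalence asserted inside (a) *)
  (has_ham_path e <->
     (forall x : T, articulation e [set: T] x ->
        #|components e (~: [set x])| = 2) /\
     (forall x y z : T,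
        articulation e [set: T] x -> articulation e [set: T] y ->
        articulation e [set: T] z -> ~ [/\ e x y, e y z & e x z]))
  /\
  (ham_path_from e u <->
     (* (a) *)
     has_ham_path e /\
     (* (b) *)
     ~~ articulation e [set: T] u /\
     (* (c) *)
     (forall x : T, articulation e [set: T] x -> x != u ->
        let Qu := component_of e (~: [set x]) u in
        ~~ k_connected e 2 Qu ->
        forall y : T, articulation e Qu y -> y != u ->
        exists v : T,
          [/\ v \in Qu, e x v & in_different_components e (Qu :\ y) u v]) /\
     (* (d) *)
     (forall x : T, articulation e [set: T] x -> x != u ->
        let Qu := component_of e (~: [set x]) u in
        k_connected e 2 Qu ->
        exists v : T,
          [/\ v \in Qu, e x v, v != u & ~~ min_vertex_cut e Qu [set u; v]]) /\
     (* (e) *)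
     ~ (exists x : T, 3 <= #|components e (~: [set u; x])|) /\
     (* (f) *)
     (k_connected e 2 [set: T] ->
        forall x y : T, min_vertex_cut e [set: T] [set x; y] ->
        #|components e (~: [set x; y])| = 2 ->
        forall Q1 Q2 : {set T},
        components e (~: [set x; y]) = [set Q1; Q2] ->
        clique e Q1 ->
        (forall v : T, v \in Q2 -> e x v -> articulation e Q2 v) ->
        u != y)).
Proof.
have ndT : nd e [set: T] by rewrite /nd /disconnected (eqP G_conn).
have ok_of_path : has_ham_path e -> articulations_ok e.
  by case=> w [p [pth up all_p]]; apply: sorted_articulations_ok (pth : sorted e (w :: p)) up all_p.
split; first by split=> [|ok]; [exact: ok_of_path|exact: has_ham_path_suff u ok].
split=> [hamu|[/ok_of_path ok [nartu [condc [condd [conde condf]]]]]].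
  have [p [pth up all_p]] := hamu; split; first by exists u.
  split; first exact: start_not_articulation pth up all_p.
  split=> [x artx nxu Qu _ y|]; first exact: start_cond_c pth up all_p _ _ artx nxu.
  split=> [x artx nxu|]; first exact: start_cond_d pth up all_p _ artx nxu.
  split=> [[x]|k2 x y /andP[cut _] c2 Q1 Q2 defc _ onlyart].
    by rewrite leqNgt ltnS (components_le2_pair e_sym pth up all_p).
  apply/negP => /eqP uy; rewrite -{y}uy in cut c2 defc.
  have nxu : x != u.
    (* For x = u the cut would be {u}, against (b). *)
    apply: contraTneq cut => ->; rewrite setUid.
    by have := start_not_articulation e_sym pth up all_p.
  have [v vQ /andP[exv]] := start_cond_f e_sym pth up all_p nxu c2 defc.
  by rewrite onlyart.
apply/ham_path_fromP.
have conde' x : #|components e (~: [set u; x])| <= 2.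
  by rewrite leqNgt; apply/negP => ge3; apply: conde; exists x.
have [/existsP[x artx]|noart] := boolP [exists x, articulation e [set: T] x].
  have nxu : x != u by apply: contraNneq nartu => <-.
  exact: articulation_start (condc x artx nxu) (condd x artx nxu) (conde' x).
have ndTx x : nd e ([set: T] :\ x).
  by apply/negP => dx; case/existsP: noart; exists x; rewrite articulationE inE.
apply: two_connected_start => // k2 x mcut c2 Q1 Q2 defc cl.
have [/exists_inP//|no] := boolP [exists v in Q2, e x v && ~~ articulation e Q2 v].
(* With y = u the conclusion of (f) is false, so its premise on the neighbours of x in Q2 must
   fail. *)
have := condf k2 x u mcut c2 Q1 Q2 defc cl; rewrite eqxx => contra.
suff : ~~ true by []; apply: contra => v vQ2 exv; apply: contraR no => nart.
by apply/exists_inP; exists v; rewrite // exv.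
Qed.
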